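(* Let $\mathbb{F}$ be an algebraically closed field of characteristic zero, let $n,m\ge1$, and let $L_{n,m}$ be the model filiform Lie superalgebra over $\mathbb{F}$. For integers $a,b\ge0$ let $\mathfrak{f}_{n,m}(a,b)$ be the number of tuples $(i_1,\dots,i_a,j_1,\dots,j_b)\in\mathbb{Z}^{a+b}$ such that $1\le i_1<\dots<i_a\le n$, $1\le j_1<\dots<j_b\le m+b-1$ and $$\sum_{s=1}^{a}i_s+\sum_{t=1}^{b}j_t=\left\lfloor\frac{a(n+1)+b(m+1)}{2}\right\rfloor+\frac{b(b-1)}{2}.$$ Then for every $k\ge0$, $$\dim\mathrm{H}^{k}(L_{n,m})=\sum_{k_0=0}^{k}\mathfrak{f}_{n,m}(k_0,k-k_0)+\sum_{k_0=0}^{k-1}\mathfrak{f}_{n,m}(k_0,k-k_0-1).$$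
   Context: $L_{n,m}$ is the Lie superalgebra with even basis elements $X_0,\dots,X_n$, odd basis elements $Y_1,\dots,Y_m$, and nonzero brackets (up to skew-supersymmetry) $[X_0,X_i]=X_{i+1}$ for $1\le i\le n-1$ and $[X_0,Y_j]=Y_{j+1}$ for $1\le j\le m-1$. For a finite-dimensional Lie superalgebra $\mathfrak{g}$, $\bigwedge^{\bullet}\mathfrak{g}^{*}$ is the super-exterior algebra of the dual superspace. It carries a $\mathbb{Z}$-degree $\|\cdot\|$ (elements of $\mathfrak{g}^*$ have degree $1$) and a parity $|\cdot|$, and $x\wedge y=(-1)^{\|x\|\|y\|+|x||y|}y\wedge x$. If $x_1,\dots,x_a$ (even), $x_{a+1},\dots,x_{a+b}$ (odd) is a basis of $\mathfrak{g}$ with $[x_k,x_l]=\sum_i a_{kl}^i x_i$, the differential is determined by $d(1)=0$, $$d(x_i^* )=\sum_{k<l}(-1)^{|x_k||x_l|}a_{kl}^i\,x_k^*x_l^*-\tfrac12\sum_{k=a+1}^{a+b}a_{kk}^i(x_k^* )^2,\qquad d(x\wedge y)=d(x)\wedge y+(-1)^{\|x\|}x\wedge d(y).$$ $\mathrm{H}^{k}(\mathfrak{g})$ is the degree-$k$ cohomology of $(\bigwedge^{\bullet}\mathfrak{g}^*,d)$ (trivial coefficients). Empty sums are $0$; for $a=b=0$ the empty tuple is counted, so $\mathfrak{f}_{n,m}(0,0)=1$. *)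

(* Defs.v *)
From HB Require Import structures.
From mathcomp Require Import all_boot all_order all_fingroup all_algebra.
Set Implicit Arguments.
Unset Strict Implicit.
Unset Printing Implicit Defensive.
Import GRing.Theory.
Local Open Scope ring_scope.

(* The superspace F^(a|b) is 'rV[F]_(a + b): its canonical basis vectors of    *)
(* index < a are even, the others are odd.                                     *)
Definition odd_idx (a b : nat) (k : 'I_(a + b)) : bool := (a <= k)%N.

Definition homogeneous (F : fieldType) (a b : nat) (p : bool)
    (u : 'rV[F]_(a + b)) : Prop :=
  forall k, odd_idx k != p -> u 0 k = 0.

(* A Lie superalgebra with a chosen homogeneous basis, a even and b odd vectors. *)
Record lieSuperalgebra (F : fieldType) (a b : nat) := LieSuperalgebra {
  sbracket : 'rV[F]_(a + b) -> 'rV[F]_(a + b) -> 'rV[F]_(a + b);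
  sbracket_linl : forall c u v w,
    sbracket (c *: u + v) w = c *: sbracket u w + sbracket v w;
  sbracket_linr : forall c u v w,
    sbracket w (c *: u + v) = c *: sbracket w u + sbracket w v;
  sbracket_homog : forall p q u v, homogeneous p u -> homogeneous q v ->
    homogeneous (p (+) q) (sbracket u v);
  sbracket_skew : forall p q u v, homogeneous p u -> homogeneous q v ->
    sbracket u v = - ((-1) ^+ (p && q) *: sbracket v u);
  sbracket_jacobi : forall p q r u v w,
    homogeneous p u -> homogeneous q v -> homogeneous r w ->
    sbracket u (sbracket v w) =
      sbracket (sbracket u v) w + (-1) ^+ (p && q) *: sbracket v (sbracket u w)
}.

Definition struct_const (F : fieldType) (a b : nat) (g : lieSuperalgebra F a b)
    (k l i : 'I_(a + b)) : F :=
  sbracket g (delta_mx 0 k) (delta_mx 0 l) 0 i.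

Section ModelFiliform.
Variables (F : fieldType) (n m : nat).

(* X_i (0 <= i <= n) has index i and Y_j (1 <= j <= m) has index n + j, so     *)
(* [X_0, e_k] = e_(k+1) for 1 <= k, k <> n, as long as k + 1 <= n + m.         *)
Definition filiform_succ (k i : 'I_(n.+1 + m)) : bool :=
  [&& (0 < k)%N, k != n :> nat & i == k.+1 :> nat].

Definition filiform_const (k l i : 'I_(n.+1 + m)) : F :=
  ((k == 0%N :> nat) && filiform_succ l i)%:R
  - ((l == 0%N :> nat) && filiform_succ k i)%:R.

Definition filiform_bracket (u v : 'rV[F]_(n.+1 + m)) : 'rV[F]_(n.+1 + m) :=
  \row_i \sum_k \sum_l u 0 k * v 0 l * filiform_const k l i.

Let X0 : 'I_(n.+1 + m) := lshift m ord0.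
Let N : 'M[F]_(n.+1 + m) := \matrix_(k, i) (filiform_succ k i)%:R.

Let bracketE u v :
  filiform_bracket u v = u 0 X0 *: (v *m N) - v 0 X0 *: (u *m N).
Proof.
have sum0 (f : 'I_(n.+1 + m) -> F) :
    \sum_k f k * (k == 0%N :> nat)%:R = f X0.
  rewrite (bigD1 X0) //= mulr1 big1 ?addr0 // => k /negPf kX0.
  by rewrite (_ : (_ == _ :> nat) = (k == X0)) ?kX0 ?mulr0.
apply/rowP => i; rewrite !mxE.
have term (x : 'I_(n.+1 + m) -> F) k l : x k * (nat_of_bool
    ((k == 0%N :> nat) && filiform_succ l i))%:R = x k * N l i * (k == 0%N :> nat)%:R.
  by rewrite mxE -mulnb natrM mulrA mulrAC.
transitivity (\sum_k \sum_l (u 0 k * N l i * (k == 0%N :> nat)%:R * v 0 l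
    - v 0 l * N k i * (l == 0%N :> nat)%:R * u 0 k)).
  apply: eq_bigr => k _; apply: eq_bigr => l _.
  by rewrite mulrBr -!term mulrAC [u 0 k * v 0 l]mulrC [in X in _ - X]mulrAC.
under eq_bigr => k _ do rewrite sumrB.
rewrite sumrB [X in _ - X]exchange_big /=.
have side (x y : 'I_(n.+1 + m) -> F) :
    \sum_k \sum_l x k * N l i * (k == 0%N :> nat)%:R * y l =
    x X0 * \sum_l y l * N l i.
  rewrite -(sum0 (fun k => x k * _)); apply: eq_bigr => k _.
  rewrite mulr_sumr mulr_suml; apply: eq_bigr => l _.
  by rewrite mulrAC -!mulrA; congr (_ * _); rewrite mulrCA.
by rewrite !side.
Qed.

Let N_X0 (u : 'rV[F]_(n.+1 + m)) : (u *m N) 0 X0 = 0.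
Proof. by rewrite mxE big1 // => k _; rewrite mxE /filiform_succ !andbF mulr0. Qed.

Let N_homog p (u : 'rV[F]_(n.+1 + m)) : homogeneous p u -> homogeneous p (u *m N).
Proof.
move=> hu i hi; rewrite mxE big1 // => k _; rewrite mxE /filiform_succ.
have [/and3P[_ kn /eqP ik]|_] := boolP [&& _, _ & _]; last by rewrite mulr0.
rewrite hu ?mul0r //; move: hi; rewrite /odd_idx ik.
by rewrite ltnS [(n < k)%N]ltn_neqAle [n == _]eq_sym kn.
Qed.

Let odd_X0 (u : 'rV[F]_(n.+1 + m)) : homogeneous true u -> u 0 X0 = 0.
Proof. exact. Qed.

Let filiform_linl c u v w : filiform_bracket (c *: u + v) w =
  c *: filiform_bracket u w + filiform_bracket v w.
Proof.
rewrite !bracketE mulmxDl -scalemxAl !mxE !(scalerDl, scalerDr, scalerN).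
by rewrite !scalerA opprD addrACA [w 0 X0 * c]mulrC.
Qed.

Let filiform_skew0 u v : filiform_bracket u v = - filiform_bracket v u.
Proof. by rewrite !bracketE opprB. Qed.

Let filiform_linr c u v w : filiform_bracket w (c *: u + v) =
  c *: filiform_bracket w u + filiform_bracket w v.
Proof.
by rewrite filiform_skew0 filiform_linl opprD -scalerN -!filiform_skew0.
Qed.

Let filiform_homog p q u v : homogeneous p u -> homogeneous q v ->
  homogeneous (p (+) q) (filiform_bracket u v).
Proof.
move=> hu hv i hi; rewrite bracketE !mxE -/(mulmx _ _).
have -> : u 0 X0 * (\sum_j v 0 j * N j i) = 0.
  case: p hu hi => [/odd_X0-> _|_ hi]; first by rewrite mul0r.
  by have := N_homog hv hi; rewrite mxE => ->; rewrite mulr0.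
have -> : v 0 X0 * (\sum_j u 0 j * N j i) = 0.
  case: q hv hi => [/odd_X0-> _|_]; first by rewrite mul0r.
  by rewrite addbF => hi; have := N_homog hu hi; rewrite mxE => ->; rewrite mulr0.
by rewrite subrr.
Qed.

Let filiform_skew p q u v : homogeneous p u -> homogeneous q v ->
  filiform_bracket u v = - ((-1) ^+ (p && q) *: filiform_bracket v u).
Proof.
case: p q => [] [] hu hv /=; rewrite ?expr0 ?scale1r -?filiform_skew0 //.
by rewrite !bracketE !odd_X0 // !scale0r subrr scaler0 oppr0.
Qed.

Let filiform_jacobi p q r u v w :
  homogeneous p u -> homogeneous q v -> homogeneous r w ->
  filiform_bracket u (filiform_bracket v w) =
    filiform_bracket (filiform_bracket u v) w
    + (-1) ^+ (p && q) *: filiform_bracket v (filiform_bracket u w).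
Proof.
move=> hu hv _.
have br0 x y : filiform_bracket x y 0 X0 = 0.
  by rewrite bracketE !scalemxAl -mulmxBl N_X0.
have E x y z : filiform_bracket x (filiform_bracket y z) =
    (x 0 X0 * y 0 X0) *: (z *m N *m N) - (x 0 X0 * z 0 X0) *: (y *m N *m N).
  rewrite bracketE br0 scale0r subr0 bracketE mulmxBl -!scalemxAl.
  by rewrite scalerBr !scalerA.
rewrite [filiform_bracket (filiform_bracket u v) w]filiform_skew0 !E.
have -> : (-1) ^+ (p && q) *: ((v 0 X0 * u 0 X0) *: (w *m N *m N)
      - (v 0 X0 * w 0 X0) *: (u *m N *m N)) =
    (v 0 X0 * u 0 X0) *: (w *m N *m N) - (v 0 X0 * w 0 X0) *: (u *m N *m N).
  case: p q hu hv => [] [] hu hv /=; rewrite ?expr0 ?scale1r //.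
  by rewrite (odd_X0 hv) !mul0r !scale0r subrr scaler0.
rewrite opprB [v 0 X0 * u 0 X0]mulrC [w 0 X0 * v 0 X0]mulrC [w 0 X0 * u 0 X0]mulrC.
by rewrite [RHS]addrC addrA subrK.
Qed.

Definition model_filiform : lieSuperalgebra F n.+1 m :=
  LieSuperalgebra filiform_linl filiform_linr filiform_homog filiform_skew
    filiform_jacobi.

End ModelFiliform.

Section SuperExterior.
Variables (F : fieldType) (a b : nat).

(* Degree k component of the tensor algebra of the dual superspace; a tensor   *)
(* is given by its coefficients on the words in the dual basis x_0^*, x_1^*, ... *)
Definition tensor (k : nat) := {ffun k.-tuple 'I_(a + b) -> F^o}.

Definition tword k (w : k.-tuple 'I_(a + b)) : tensor k :=
  [ffun v => (v == w)%:R].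

Definition dual (i : 'I_(a + b)) : tensor 1 := tword [tuple i].

Definition tmul k l (u : tensor k) (v : tensor l) : tensor (k + l) :=
  [ffun w => u [tuple tnth w (lshift l s) | s < k]
             * v [tuple tnth w (rshift k t) | t < l]].

(* The degree k component of the super-exterior algebra is the quotient of      *)
(* tensor k by ext_ideal k, the degree k part of the two-sided ideal generated  *)
(* by the x_i^* x_j^* - (-1)^(1 + |x_i||x_j|) x_j^* x_i^*. Below, s and t are   *)
(* two consecutive positions of the word w.                                     *)
Definition ext_ideal (k : nat) : {vspace tensor k} :=
  (\sum_(w : k.-tuple 'I_(a + b)) \sum_(s : 'I_k) \sum_(t : 'I_k | t == s.+1 :> nat)
     <[tword w - (-1) ^+ (1 + odd_idx (tnth w s) * odd_idx (tnth w t))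
                 *: tword [tuple tnth w (tperm s t r) | r < k]]>)%VS.

Variable g : lieSuperalgebra F a b.

Definition diff_dual (i : 'I_(a + b)) : tensor 2 :=
  \sum_(k : 'I_(a + b)) \sum_(l : 'I_(a + b) | (k < l)%N)
     ((-1) ^+ (odd_idx k * odd_idx l) * struct_const g k l i)
       *: (tmul (dual k) (dual l) : tensor 2)
  - 2%:R^-1 *: \sum_(k | odd_idx k)
     struct_const g k k i *: (tmul (dual k) (dual k) : tensor 2).

Definition tbehead k (i : 'I_(a + b)) (u : tensor k.+1) : tensor k :=
  [ffun w : k.-tuple 'I_(a + b) => u [tuple of i :: w]].

(* The derivation extending diff_dual to the tensor algebra: as u is the sum    *)
(* of the x_i^* * tbehead i u, this is the graded Leibniz rule. It preserves    *)
(* the ideal, and so induces the differential on the super-exterior algebra.    *)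
Fixpoint diff (k : nat) : tensor k -> tensor k.+1 :=
  if k is k'.+1 return tensor k -> tensor k.+1 then
    fun u => \sum_i ((tmul (diff_dual i) (tbehead i u) : tensor k'.+2)
                     - (tmul (dual i) (diff (tbehead i u)) : tensor k'.+2))
  else fun=> 0.

Lemma diff_is_linear k : linear (@diff k).
Proof.
have tmul_linr p q (x : tensor p) : linear (tmul x : tensor q -> _).
  by move=> c u v; apply/ffunP => w; rewrite !ffunE mulrDr; congr (_ + _); exact: mulrCA.
have tbehead_linear q i : linear (@tbehead q i).
  by move=> c u v; apply/ffunP => w; rewrite !ffunE.
elim: k => [|k IHk] c u v /=; first by rewrite scaler0 addr0.
rewrite scaler_sumr -big_split /=; apply: eq_bigr => i _.
by rewrite tbehead_linear IHk !tmul_linr scalerBr opprD addrACA.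
Qed.

HB.instance Definition _ k :=
  GRing.isLinear.Build F (tensor k) (tensor k.+1) _ (@diff k) (@diff_is_linear k).

(* The preimages in tensor k of the cocycles and coboundaries of the degree k   *)
(* component; both contain ext_ideal k, so H^k is the quotient of the former by *)
(* the latter.                                                                  *)
Definition cocycles (k : nat) : {vspace tensor k} :=
  (linfun (@diff k) @^-1: ext_ideal k.+1)%VS.

Definition coboundaries (k : nat) : {vspace tensor k} :=
  if k is k'.+1 return {vspace tensor k} then
    (limg (linfun (@diff k')) + ext_ideal k'.+1)%VS
  else ext_ideal 0.

Definition dim_cohomology (k : nat) : nat :=
  (\dim (cocycles k) - \dim (coboundaries k))%N.

End SuperExterior.

(* Entries are natural numbers: 'I_n.+1 and 'I_(m + b) impose i_s <= n and      *)
(* j_t <= m + b - 1, and path ltn 0 gives 0 < i_1 < i_2 < ...                   *)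
Definition filiform_count (n m a b : nat) : nat :=
  #|[set ij : a.-tuple 'I_n.+1 * b.-tuple 'I_(m + b) |
      [&& path ltn 0%N (map val ij.1), path ltn 0%N (map val ij.2)
        & (\sum_(s < a) tnth ij.1 s + \sum_(t < b) tnth ij.2 t ==
             (a * n.+1 + b * m.+1) %/ 2 + (b * b.-1) %/ 2)%N]]|.

(* Main.v *)
From HB Require Import structures.
Require Import Defs.
From mathcomp Require Import all_boot all_order all_fingroup all_algebra.
From mathcomp Require Import zify ring.
Set Implicit Arguments.
Unset Strict Implicit.
Unset Printing Implicit Defensive.
Import Order.TTheory GRing.Theory Num.Theory.

(* Modulo the ideal, the differential is [X_0^* D], where [D] is the degree 0  *)
(* derivation sending each [X_(i+1)^*] to [X_i^*] and each [Y_(j+1)^*] to      *)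
(* [Y_j^*]. The span of the monomials without [X_0^*] is a representation of   *)
(* sl_2 in which [D] is the lowering operator, so [D] is injective on positive *)
(* weights and onto negative target weights; hence its corank is the number of *)
(* monomials of weight 0 or -1. Each such monomial of degree k contributes to  *)
(* H^k (as a kernel) and, multiplied by [X_0^*], to H^(k+1) (as a cokernel).   *)
(* Subtracting t - 1 from [j_t] turns the strictly increasing [j_1 < ... < j_b] *)
(* of the statement into the odd part of a sorted monomial.                    *)

(** * Rank of a lowering operator *)

(** The cohomology is computed by rank counting. Normal words, sorted and without repeated even
    letter, form a basis of the super-exterior algebra ([nproj_eq0], [dim_limg_nproj]), so dim H^k
    is the number of normal words of degree k minus the ranks of the differentials leaving and
    entering degree k ([dim_cohomologyS]).

    Since d = X_0^* D modulo the ideal ([diff_lower]) and the square of X_0^* is zero, the rank of d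
    on degree k is the rank of D on the f_k normal words free of X_0^* ([diff_rankE]). There an
    explicit raising operator satisfies the sl_2 relation with D ([raise_lower_comm], [tder_comm]),
    which forces this rank to be f_k - m_k, where m_k counts the words of weight 0 or -1
    ([rank_lowering], [rank_tder_lower]). As degree k has f_k + f_(k-1) normal words
    ([card_normal_setS]), dim H^k = m_k + m_(k-1).

    A word with a even and b odd letters whose indices sum to S has weight 2 S - a (n + 1) - b (m +
    1). It is 0 or -1 exactly when S is the rounded-down half in the statement ([middle_weight]),
    and the staircase shift of the odd indices identifies such words with the counted tuples
    ([card_middle_part]). *)

Section WeightedMatrices.
Local Open Scope ring_scope.
Variables (F : fieldType) (N : nat).
Hypothesis charF : [pchar F] =i pred0.

Definition shifts_weight (h : 'I_N -> int) (d : int) (M : 'M[F]_N) :=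
  forall i j, M i j != 0 -> h j = h i + d.

Definition weight_proj (P : pred 'I_N) : 'M[F]_N :=
  diag_mx (\row_i (P i)%:R).

(** Subadditivity bounds the ranks of two complementary projections by the sizes of their supports;
    the projections sum to the identity, of rank [N], so both bounds are attained. *)
Lemma rank_weight_proj (P : pred 'I_N) : \rank (weight_proj P) = #|P|.
Proof.
have le Q : (\rank (weight_proj Q) <= #|Q|)%N.
  have -> : weight_proj Q = \sum_(i | Q i) delta_mx i i.
    apply/matrixP => i j; rewrite !mxE summxE.
    under eq_bigr => k _ do rewrite mxE.
    have [<-|ij] := eqVneq i j; last first.
      by rewrite mulr0n big1 // => k _; case: eqP => //= <-; rewrite eq_sym (negPf ij).
    rewrite mulr1n big_mkcond (bigD1 i) //= !eqxx big1 ?addr0; first by case: (Q i).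
    by move=> k ki; rewrite eq_sym (negPf ki) if_same.
  rewrite -sum1_card; elim/big_ind2: _ => [|m1 A m2 B hA hB|i _].
  - by rewrite mxrank0.
  - exact: leq_trans (mxrank_add _ _) (leq_add hA hB).
  - by rewrite mxrank_delta.
apply/eqP; rewrite eqn_leq le /=.
have : (N <= \rank (weight_proj P) + \rank (weight_proj (predC P)))%N.
  rewrite -[leqLHS](mxrank1 F) (_ : 1%:M = weight_proj P + weight_proj (predC P)).
    exact: mxrank_add.
  apply/matrixP => i j; rewrite !mxE -mulrnDl -natrD.
  by rewrite /predC /=; case: (P i).
have cP : (#|P| + #|predC P| = N)%N by rewrite cardC card_ord.
move/leq_trans/(_ (leq_add (leqnn _) (le (predC P)))).
by rewrite -{1}cP leq_add2r.
Qed.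

Lemma intr_pchar0_eq0 (z : int) : (z%:~R == 0 :> F) = (z == 0).
Proof.
have F0 n : (n%:R == 0 :> F) = (n == 0)%N by move: n; apply/pcharf0P.
case: z => n; first by rewrite -pmulrn F0.
by rewrite NegzE rmorphN /= oppr_eq0 -pmulrn F0.
Qed.

Lemma weight_mulmx (h : 'I_N -> int) d M mu (v : 'rV[F]_N) :
  shifts_weight h d M -> (forall i, v 0 i != 0 -> h i = mu) ->
  forall j, (v *m M) 0 j != 0 -> h j = mu + d.
Proof.
move=> hM hv j; rewrite mxE => nz.
have [i /andP[vi Mi]] : exists i, (v 0 i != 0) && (M i j != 0).
  apply/existsP; apply: contra_neqT nz => /existsPn nz.
  rewrite big1 // => i _; have := nz i.
  by rewrite negb_and !negbK => /orP[]/eqP->; rewrite ?mul0r ?mulr0.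
by rewrite (hM i j Mi) (hv i vi).
Qed.

Section Sl2.
Variables (h : 'I_N -> int) (D E : 'M[F]_N).
Hypothesis hD : shifts_weight h (-2) D.
Hypothesis hE : shifts_weight h 2 E.
Hypothesis comm : E *m D = D *m E - diag_mx (\row_i (h i)%:~R).

(* With [v_j = v E^j], the commutation relation gives                        *)
(* [v_(j+1) D = - (j + 1) (mu + j) v_j] while [v_j] vanishes for large [j].  *)
Lemma lowering_inj_homog mu (v : 'rV[F]_N) : 0 < mu ->
  (forall i, v 0 i != 0 -> h i = mu) -> v *m D = 0 -> v = 0.
Proof.
move=> mu0 hv vD; pose w j := iter j (mulmxr E) v.
have hw j : forall i, w j 0 i != 0 -> h i = mu + j%:Z * 2.
  elim: j => [|j IH] i; first by rewrite mul0r addr0; exact: hv.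
  by move/(weight_mulmx hE IH) => ->; lia.
have wH j : w j *m diag_mx (\row_i (h i)%:~R) = (mu + j%:Z * 2)%:~R *: w j.
  apply/rowP => i; rewrite mul_mx_diag !mxE mulrC.
  by have [->|/hw->] := eqVneq (w j 0 i) 0; rewrite ?mulr0.
have wD j : w j.+1 *m D = - (j.+1%:Z * (mu + j%:Z))%:~R *: w j.
  have stepE i : w i.+1 = w i *m E by [].
  elim: j => [|j IH]; rewrite stepE -mulmxA comm mulmxBr mulmxA wH.
    rewrite vD mul0mx sub0r scaleNr; congr (- (intmul _ _ *: _)); ring.
  rewrite IH -scalemxAl -stepE -scalerBl; congr (_ *: _).
  rewrite !intS; ring.
(* For this [J], a nonzero coordinate of [w J] would have weight mu + 2 J, which exceeds every
   [|h i|]. *)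
have [J wJ] : exists J, w J = 0.
  exists (\sum_i `|h i|)%N; apply/rowP => i; rewrite [RHS]mxE; apply/eqP.
  apply: contraT => /hw hi; have : (`|h i| <= \sum_i `|h i|)%N.
    by rewrite (bigD1 i) //= leq_addr.
  by lia.
(* Descent to [w 0 = v]: if [w J.+1] vanishes, so does (J + 1)(mu + J) [w J], and the scalar is
   nonzero in characteristic zero because mu is positive. *)
elim: J wJ => // J IH wJ; apply: IH; apply/eqP.
have /eqP := wD J; rewrite wJ mul0mx eq_sym scaler_eq0 oppr_eq0 intr_pchar0_eq0.
by case/orP => //; lia.
Qed.

(** [D] moves all weights by the same amount, so each homogeneous component of a kernel vector lies
    in the kernel. *)
Lemma lowering_inj (v : 'rV[F]_N) :
  (forall i, v 0 i != 0 -> 0 < h i) -> v *m D = 0 -> v = 0.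
Proof.
move=> hv vD; apply/rowP => i; rewrite [RHS]mxE; apply/eqP/contraT => vi.
pose u : 'rV[F]_N := \row_j (if h j == h i then v 0 j else 0).
suff u0 : u = 0.
  by move: vi; have /rowP/(_ i) := u0; rewrite !mxE !eqxx => ->; rewrite eqxx.
apply: (@lowering_inj_homog (h i)); first exact: hv.
  by move=> j; rewrite mxE; case: (h j =P h i) => // _; rewrite eqxx.
apply/rowP => j; rewrite !mxE.
have [hj|hj] := eqVneq (h j) (h i + -2).
  have /rowP/(_ j) := vD; rewrite !mxE => {2}<-; apply: eq_bigr => k _; rewrite mxE.
  have [->|/hD hk] := eqVneq (D k j) 0; first by rewrite !mulr0.
  by case: eqP => //; rewrite hk in hj; lia.
rewrite big1 // => k _; rewrite mxE; have [->|/hD hk] := eqVneq (D k j) 0.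
  by rewrite mulr0.
by case: eqP => [e|]; rewrite ?mul0r // ; rewrite hk e eqxx in hj.
Qed.

Lemma rank_lowering_proj (P : pred 'I_N) : (forall i, P i -> 0 < h i) ->
  \rank (weight_proj P *m D) = #|P|.
Proof.
move=> hP; have := mxrank_mul_ker (weight_proj P) D.
suff /eqP -> : (weight_proj P :&: kermx D)%MS == 0.
  by rewrite mxrank0 addn0 => ->; rewrite rank_weight_proj.
apply/rowV0P => v; rewrite sub_capmx => /andP[/submxP[u ->] /sub_kermxP].
apply: lowering_inj => i; rewrite mul_mx_diag !mxE.
by case: (boolP (P i)) => [/hP|]; rewrite ?mulr0 ?eqxx.
Qed.
End Sl2.

(** [D] sends weights above 0 to weights at least -1, and the others to weights below -1, so it
    splits into two blocks. The first is injective and so is the transpose of the second; their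
    ranks are the number of sources of weight above 0 and the number of targets of weight below -1.
    Only the weights 0 and -1 are left over. *)
Lemma rank_lowering (h : 'I_N -> int) (D E : 'M[F]_N) :
  shifts_weight h (-2) D -> shifts_weight h 2 E ->
  E *m D = D *m E - diag_mx (\row_i (h i)%:~R) ->
  (\rank D + #|[pred i | ((h i == 0) || (h i == -1))%R]|)%N = N.
Proof.
move=> hD hE comm.
pose A : pred 'I_N := [pred i | 0 < h i]; pose B : pred 'I_N := [pred i | h i < -1].
have rA : \rank (weight_proj A *m D) = #|A| by apply: (rank_lowering_proj hD hE comm).
have rB : \rank (D *m weight_proj B) = #|B|.
  rewrite -mxrank_tr trmx_mul tr_diag_mx.
  (* Transposition exchanges sources and targets: [D^T] lowers the opposite weight [- h], with [E^T]
     as its raising partner. *)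
  apply: (@rank_lowering_proj (fun i => - h i) D^T E^T).
  - by move=> i j; rewrite mxE => /hD; lia.
  - by move=> i j; rewrite mxE => /hE; lia.
  - rewrite -!trmx_mul comm linearB /= tr_diag_mx -addrA -opprD -linearD /=.
    have -> : \row_i (h i)%:~R + \row_i (- h i)%:~R = 0 :> 'rV[F]_N.
      by apply/rowP => i; rewrite !mxE rmorphN subrr.
    by rewrite linear0 subr0.
  - by move=> i; rewrite /B /=; lia.
have ADproj : weight_proj A *m D = D *m weight_proj (predC B).
  apply/matrixP => i j; rewrite mul_diag_mx mul_mx_diag !mxE [RHS]mulrC.
  have [->|/hD hij] := eqVneq (D i j) 0; first by rewrite !mulr0.
  by congr (_%:R * _); rewrite /A /B /= hij; lia.
have nADproj : weight_proj (predC A) *m D = D *m weight_proj B.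
  apply/matrixP => i j; rewrite mul_diag_mx mul_mx_diag !mxE [RHS]mulrC.
  have [->|/hD hij] := eqVneq (D i j) 0; first by rewrite !mulr0.
  by congr (_%:R * _); rewrite /A /B /= hij; lia.
have projD (P : pred 'I_N) : weight_proj P + weight_proj (predC P) = 1%:M.
  apply/matrixP => i j; rewrite !mxE -mulrnDl -natrD /predC /=.
  by case: (P i).
have Dsum : (D :=: weight_proj A *m D + D *m weight_proj B)%MS.
  apply/eqmxP/andP; split.
    have {1}-> : D = weight_proj A *m D + D *m weight_proj B.
      by rewrite -nADproj -mulmxDl projD mul1mx.
    exact: addmx_sub_adds.
  by rewrite addsmx_sub -nADproj !submxMl.
rewrite Dsum mxrank_disjoint_sum ?rA ?rB; last first.
  apply/eqP/rowV0P => v; rewrite sub_capmx => /andP[/submxP[u]].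
  rewrite ADproj mulmxA => -> /submxP[u'] /rowP e; apply/rowP => i.
  move: (e i); rewrite mulmxA !mul_mx_diag !mxE /predC /=.
  by case: (B i); rewrite ?mulr0.
set M := [pred i | _]; have := cardC A; rewrite card_ord.
suff -> : #|predC A| = (#|B| + #|M|)%N by rewrite addnA.
rewrite -[LHS](cardID B); congr (_ + _)%N; apply: eq_card => i;
  rewrite !inE /A /B /=; lia.
Qed.
End WeightedMatrices.

(** * Dimensions of spans as matrix ranks *)

Section SpanRank.
Local Open Scope ring_scope.
Variables (F : fieldType) (V : vectType F).

Lemma sum_scale_sum (p q : nat) (c : 'I_p -> F) (A : 'M[F]_(p, q)) (g : 'I_q -> V) :
  \sum_i c i *: (\sum_j A i j *: g j) = \sum_j ((\row_i c i) *m A) 0 j *: g j.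
Proof.
under eq_bigr => i _ do rewrite scaler_sumr.
rewrite exchange_big; apply: eq_bigr => j _.
rewrite mxE scaler_suml; apply: eq_bigr => i _.
by rewrite mxE scalerA.
Qed.


(** A basis of the row space of [A] gives independent combinations of [g] with the same span. This
    turns dimensions of images in tensor spaces into matrix ranks. *)
Lemma dim_span_mx (p q : nat) (A : 'M[F]_(p, q)) (g : 'I_q -> V) :
  (forall c : 'I_q -> F, \sum_j c j *: g j = 0 -> forall j, c j = 0) ->
  \dim (\sum_i <[\sum_j A i j *: g j]>) = \rank A.
Proof.
move=> gfree.
have ginj (u : 'rV[F]_q) : \sum_j u 0 j *: g j = 0 -> u = 0.
  by move=> /gfree u0; apply/rowP => j; rewrite u0 mxE.
pose B := row_base A.
pose X := [tuple \sum_j B i j *: g j | i < \rank A].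
have XE (i : 'I_(\rank A)) : X`_i = \sum_j B i j *: g j.
  by rewrite -tnth_nth tnth_mktuple.
have Xfree : free X.
  apply/freeP => c; under eq_bigr do rewrite XE.
  rewrite sum_scale_sum => /ginj /eqP cB i.
  have : \row_i c i == 0 by rewrite -(mulmx_free_eq0 _ (row_base_free A)).
  by move/eqP/rowP/(_ i); rewrite !mxE.
have incl p1 p2 (A1 : 'M[F]_(p1, q)) (A2 : 'M[F]_(p2, q)) i :
    (A1 <= A2)%MS ->
    \sum_j A1 i j *: g j \in (\sum_i <[\sum_j A2 i j *: g j]>)%VS.
  case/submxP => C A1E.
  rewrite (_ : \sum_j _ = \sum_k C i k *: \sum_j A2 k j *: g j).
    apply: memv_suml => k _; apply: memvZ.
    by apply: (subvP (sumv_sup k _ _)) (memv_line _).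
  rewrite sum_scale_sum; apply: eq_bigr => j _; congr (_ *: _).
  by rewrite A1E !mxE; apply: eq_bigr => k _; rewrite mxE.
have -> : (\sum_i <[\sum_j A i j *: g j]> = <<X>>)%VS.
  rewrite span_def big_tuple; under [RHS]eq_bigr => i _ do rewrite tnth_mktuple.
  apply/eqP; rewrite eqEsubv; apply/andP; split; apply/subv_sumP => i _;
    rewrite -memvE; apply: incl; by rewrite eq_row_base.
by have /eqP-> := Xfree; rewrite size_tuple.
Qed.
End SpanRank.

(** * Normal forms in the super-exterior algebra *)

Section Inversions.
Variables (T : eqType) (e : rel T).

Fixpoint inversions (s : seq T) : nat :=
  if s is x :: s' then count (e x) s' + inversions s' else 0.

(** Transposing two neighbours affects only their own pair; the additive form avoids truncated
    subtraction. *)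
Lemma inversions_swap p x y q :
  inversions (p ++ x :: y :: q) + e y x = inversions (p ++ y :: x :: q) + e x y.
Proof.
elim: p => [|z p IH] /=; first by lia.
rewrite -!addnA IH; congr (_ + _); rewrite !count_cat /=; lia.
Qed.

Lemma unsorted_adjacent s : ~~ sorted e s ->
  exists p x y q, s = p ++ x :: y :: q /\ ~~ e x y.
Proof.
elim: s => [|x [|y s] IH] //=; rewrite negb_and => /orP[exy|/IH].
  by exists [::], x, y, s.
by case=> p [x' [y' [q [-> exy]]]]; exists (x :: p), x', y', q.
Qed.
End Inversions.

Section ExteriorNormalForm.
Local Open Scope ring_scope.
Variables (F : fieldType) (a b : nat).
Local Notation L := 'I_(a + b).
Local Notation tensor := (tensor F a b).
Local Notation ext_ideal := (ext_ideal F a b).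
Implicit Types (p q w : seq L) (i j x y : L).

(* A word of length other than [k] gives the zero tensor. *)
Definition wtensor k w : tensor k := [ffun v : k.-tuple L => (tval v == w)%:R].

(** The generators of [ext_ideal] with the two signs combined. Both terms are zero when the word
    does not have length [k], so [p] and [q] may be arbitrary. *)
Definition swap_rel k p x y q : tensor k :=
  wtensor k (p ++ x :: y :: q)
  + (-1) ^+ (odd_idx x * odd_idx y) *: wtensor k (p ++ y :: x :: q).

Lemma wtensor_size k w : size w != k -> wtensor k w = 0.
Proof.
move=> sz; apply/ffunP => v; rewrite !ffunE; case: eqP => // vw.
by rewrite -vw size_tuple eqxx in sz.
Qed.

Lemma wtensor_tuple k (w : k.-tuple L) : wtensor k w = tword F w.
Proof. by apply/ffunP => v; rewrite !ffunE. Qed.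

Lemma tensorE k (u : tensor k) : u = \sum_w u w *: wtensor k w.
Proof.
apply/ffunP => v; rewrite sum_ffunE (bigD1 v) //= !ffunE eqxx.
rewrite big1 => [|w wv]; first by rewrite addr0 [RHS]mulr1.
by rewrite wtensor_tuple !ffunE eq_sym (negPf wv) [LHS]mulr0.
Qed.

Lemma tnth_split k (w : k.-tuple L) (s t : 'I_k) : t = s.+1 :> nat ->
  tval w = take s w ++ tnth w s :: tnth w t :: drop t.+1 w.
Proof.
move=> ts; have x0 := tnth w s; rewrite !(tnth_nth x0).
rewrite -drop_nth ?size_tuple // ts -drop_nth ?size_tuple ?cat_take_drop //.
Qed.

Lemma tnth_swap k (w : k.-tuple L) (s t : 'I_k) : t = s.+1 :> nat ->
  tval [tuple tnth w (tperm s t r) | r < k] =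
    take s w ++ tnth w t :: tnth w s :: drop t.+1 w.
Proof.
move=> ts; have x0 := tnth w s; have tk := ltn_ord t.
have szs : size (take s w) = s by rewrite size_takel // size_tuple ltnW.
apply: (@eq_from_nth _ x0) => [|r].
  by rewrite size_tuple size_cat /= size_drop size_tuple szs ts; lia.
rewrite size_tuple => rk; rewrite -[r]/(val (Ordinal rk)) -tnth_nth tnth_mktuple.
rewrite nth_cat szs; case: tpermP => [->|->|/eqP rs /eqP rt] /=.
- by rewrite ltnn subnn.
- by rewrite ts ltnNge leqnSn /= subSnn /=.
rewrite (tnth_nth x0) /=; case: ltnP => [rs'|sr]; first by rewrite nth_take.
have [d rE] : exists d, r = (d + t.+1)%N.
  exists (r - t.+1)%N; move: rs rt; rewrite -!val_eqE /= ts; lia.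
rewrite rE; have -> : (d + t.+1 - s)%N = d.+2 by lia.
by rewrite /= nth_drop [(t.+1 + d)%N]addnC.
Qed.

Lemma swap_rel_ideal k p x y q : swap_rel k p x y q \in ext_ideal k.
Proof.
have [sz|sz] := eqVneq (size (p ++ x :: y :: q)) k; last first.
  have sz' : size (p ++ y :: x :: q) != k by rewrite !size_cat /= in sz *.
  by rewrite /swap_rel !wtensor_size // scaler0 addr0 mem0v.
pose w := Tuple (introT eqP sz).
have sk : (size p < k)%N by rewrite -sz size_cat /=; lia.
have tk : ((size p).+1 < k)%N by rewrite -sz size_cat /=; lia.
pose s := Ordinal sk; pose t := Ordinal tk.
have ws : tnth w s = x by rewrite (tnth_nth x) /= nth_cat ltnn subnn.
have wt : tnth w t = y.
  by rewrite (tnth_nth x) /= nth_cat ltnNge leqnSn subSnn.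
apply: (subvP (sumv_sup w _ (subvv _))) => //.
apply: (subvP (sumv_sup s _ (subvv _))) => //.
apply: (subvP (sumv_sup t _ (subvv _))) => //.
rewrite (_ : swap_rel k p x y q = tword F w
    - (-1) ^+ (1 + odd_idx (tnth w s) * odd_idx (tnth w t))
      *: tword F [tuple tnth w (tperm s t r) | r < k]); first exact: memv_line.
rewrite ws wt exprD expr1 mulN1r scaleNr opprK -!wtensor_tuple.
congr (_ + _ *: wtensor _ _); rewrite tnth_swap // ws wt /=.
by rewrite take_size_cat // drop_cat ltnNge leqW //= subSn // subSnn /= drop0.
Qed.

Lemma ext_ideal_sub k (U : {vspace tensor k}) :
  (forall p x y q, swap_rel k p x y q \in U) -> (ext_ideal k <= U)%VS.
Proof.
move=> relU; apply/subv_sumP => w _; apply/subv_sumP => s _.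
apply/subv_sumP => t /eqP ts; rewrite -memvE.
have := relU (take s w) (tnth w s) (tnth w t) (drop t.+1 w).
rewrite /swap_rel -(tnth_split _ ts) -(tnth_swap _ ts) !wtensor_tuple.
by rewrite exprD expr1 mulN1r scaleNr opprK.
Qed.

Lemma ext_ideal_stable k l (f : {linear tensor k -> tensor l}) :
  (forall p x y q, f (swap_rel k p x y q) \in ext_ideal l) ->
  {in ext_ideal k, forall u, f u \in ext_ideal l}.
Proof.
move=> frel u uI; rewrite -(lfunE f) memv_preim.
apply: (subvP (ext_ideal_sub _) u uI) => p x y q.
by rewrite -memv_preim lfunE; exact: frel.
Qed.

(** Left multiplication by the dual basis vector of [i] (see [tmul_dual]), written on head and tail
    to suit induction on words. *)
Definition lcons k i (u : tensor k) : tensor k.+1 :=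
  [ffun w : k.+1.-tuple L => (thead w == i)%:R * u [tuple of behead w]].

Lemma lcons_linear k i : linear (@lcons k i).
Proof.
move=> c u v; apply/ffunP => w; rewrite !ffunE mulrDr; congr (_ + _).
exact: mulrCA.
Qed.

HB.instance Definition _ k i :=
  GRing.isLinear.Build F (tensor k) (tensor k.+1) _ (@lcons k i) (@lcons_linear k i).

Lemma lcons_wtensor k i w : lcons i (wtensor k w) = wtensor k.+1 (i :: w).
Proof.
apply/ffunP; case/tupleP => x v; rewrite !ffunE /= theadE eqseq_cons.
by rewrite -natrM mulnb.
Qed.

Lemma lcons_ideal k i : {in ext_ideal k, forall u, lcons i u \in ext_ideal k.+1}.
Proof.
apply: ext_ideal_stable => p x y q.
rewrite /swap_rel linearD linearZ /= !lcons_wtensor.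
exact: (swap_rel_ideal _ (i :: p)).
Qed.

Lemma tensor_lconsE k (u : tensor k.+1) : u = \sum_i lcons i (tbehead i u).
Proof.
apply/ffunP; case/tupleP => x v; rewrite sum_ffunE (bigD1 x) //= !ffunE.
rewrite theadE eqxx mul1r big1 => [|y yx]; rewrite ?addr0.
  by congr (u _); apply: val_inj.
by rewrite !ffunE theadE eq_sym (negPf yx) mul0r.
Qed.

Definition wle : rel L := relpre val leq.
Definition wsort := sort wle.
(** Odd letters may repeat and even ones may not: the words sorted in this sense index the monomial
    basis of the super-exterior algebra. *)
Definition normal_step : rel L :=
  fun x y => (x < y)%N || (x == y) && odd_idx x.
Definition normal_word := sorted normal_step.
(** Two odd letters commute in the super-exterior algebra, so only pairs involving an even letter
    contribute a sign. *)
Definition sign_inv : rel L := fun x y => (y < x)%N && ~~ (odd_idx x && odd_idx y).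

(* The coefficient of the sorted word in the class of the word [w]. *)
Definition wsign w : F :=
  if normal_word (wsort w) then (-1) ^+ inversions sign_inv w else 0.

Lemma wle_total : total wle. Proof. by move=> x y; exact: leq_total. Qed.
Lemma wle_trans : transitive wle. Proof. by move=> y x z; exact: leq_trans. Qed.
Lemma wle_anti : antisymmetric wle.
Proof. by move=> x y; rewrite /wle /= -eqn_leq => /eqP/val_inj. Qed.

Lemma normal_step_trans : transitive normal_step.
Proof.
move=> y x z /orP[xy|/andP[/eqP-> _]] // /orP[yz|/andP[/eqP<- _]] //.
by rewrite /normal_step (ltn_trans xy yz).
Qed.

Lemma normal_sorted w : normal_word w -> sorted wle w.
Proof.
by apply: sub_sorted => x y /orP[/ltnW|/andP[/eqP->]] //; rewrite /wle /=.
Qed.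

Lemma wsort_swap p x y q : wsort (p ++ x :: y :: q) = wsort (p ++ y :: x :: q).
Proof.
apply/(perm_sortP wle_total wle_trans wle_anti).
by rewrite perm_cat2l; apply/seq.permP => P /=; rewrite addnCA.
Qed.

Lemma wsort_sorted w : sorted wle w -> wsort w = w.
Proof. exact: sorted_sort wle_trans _. Qed.

Lemma inversions_sorted w : sorted wle w -> inversions sign_inv w = 0%N.
Proof.
elim: w => //= x s IHs; rewrite (path_sortedE wle_trans) => /andP[xs /IHs ->].
rewrite addn0; apply/eqP; rewrite -leqn0 leqNgt -has_count -all_predC.
by apply: sub_all xs => y; rewrite /wle /sign_inv /= ltnNge => ->.
Qed.

Lemma normal_even_count w x : normal_word (wsort w) -> ~~ odd_idx x ->
  (count_mem x w <= 1)%N.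
Proof.
move=> + xeven; have /seq.permP/(_ (pred1 x)) <- : perm_eq (wsort w) w.
  by rewrite perm_sort.
rewrite /normal_word (sorted_pairwise normal_step_trans) -/(wsort w).
elim: (wsort w) => //= y s IH /andP[/allP ys /IH]; case: eqP => // yx.
rewrite yx in ys; move=> _; suff -> : count_mem x s = 0%N by [].
apply/count_memPn/negP => /ys; rewrite /normal_step ltnn eqxx.
by rewrite (negPf xeven).
Qed.

(** Exchanging distinct neighbours that are not both odd changes the number of signed inversions by
    one; for two odd letters the sign comes from the factor (-1)^(|x||y|); equal even neighbours are
    excluded by normality. Hence sorting with signs kills the ideal. *)
Lemma wsign_swap p x y q :
  wsign (p ++ x :: y :: q)
  + (-1) ^+ (odd_idx x * odd_idx y) * wsign (p ++ y :: x :: q) = 0.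
Proof.
rewrite /wsign -wsort_swap; case: ifP => [nw|_]; last by rewrite mulr0 addr0.
have := inversions_swap sign_inv p x y q; rewrite /sign_inv [odd_idx y && _]andbC.
rewrite mulnb; case: (boolP (odd_idx x && odd_idx y)) => [_|xy].
  by rewrite !andbF !addn0 => ->; rewrite expr1 mulN1r subrr.
rewrite !andbT expr0 mul1r; case: ltngtP => [_|_|exy].
- by rewrite addn0 addn1 => <-; rewrite exprS mulN1r subrr.
- by rewrite addn0 addn1 => ->; rewrite exprS mulN1r addNr.
have yx : y = x by apply: val_inj.
move: nw xy; rewrite yx andbb => nw /(normal_even_count nw).
by rewrite count_cat /= eqxx; lia.
Qed.

Lemma wtensor_swap k p x y q :
  wtensor k (p ++ x :: y :: q) = swap_rel k p x y q
    - (-1) ^+ (odd_idx x * odd_idx y) *: wtensor k (p ++ y :: x :: q).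
Proof. by rewrite /swap_rel addrK. Qed.

(* Bubble sort: each transposition of adjacent letters changes both sides by *)
(* the same sign modulo the ideal. *)
Lemma wtensor_sort k w : 2%:R != 0 :> F ->
  wtensor k w - wsign w *: wtensor k (wsort w) \in ext_ideal k.
Proof.
move=> two_neq0; have [d] := ubnP (inversions (fun x y => (y < x)%N) w).
elim: d w => // d IH w wd.
have [ws|/unsorted_adjacent[p [x [y [q [wE]]]]]] := boolP (sorted wle w); last first.
  rewrite /wle /= -ltnNge => yx.
  have := inversions_swap (fun x y : L => (y < x)%N) p x y q.
  rewrite -wE yx (ltnNge x y) (ltnW yx) addn0 addn1 => inv.
  have /IH : (inversions (fun x y : L => (y < x)%N) (p ++ y :: x :: q) < d)%N by lia.
  have := wsign_swap p x y q; rewrite wsort_swap -wsort_swap -wE.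
  move/eqP; rewrite addr_eq0 => /eqP -> hI.
  rewrite {1}wE wtensor_swap scaleNr opprK wE wsort_swap -addrA.
  rewrite rpredD ?swap_rel_ideal //.
  by rewrite addrC -scalerA -scalerBr -opprB scalerN rpredN rpredZ.
rewrite /wsign (wsort_sorted ws).
have [nw|/unsorted_adjacent[p [x [y [q [wE]]]]]] := boolP (normal_word w).
  by rewrite inversions_sorted // expr0 scale1r subrr mem0v.
rewrite /normal_step negb_or -leqNgt => /andP[yx xy]; rewrite scale0r subr0.
have eqxy : x = y.
  apply: wle_anti; rewrite /wle /= yx andbT.
  move: ws; rewrite wE (sorted_pairwise wle_trans) pairwise_cat /=.
  by case/and4P => _ _ /andP[].
move: xy; rewrite eqxy eqxx /= => yeven; subst x.
(* For a repeated even letter the relation is twice the word itself, so inverting 2 puts the word in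
   the ideal. *)
have := swap_rel_ideal k p y y q; rewrite /swap_rel -wE mulnb.
rewrite (negPf yeven) expr0 scale1r.
rewrite -mulr2n -scaler_nat => /(memvZ 2%:R^-1); by rewrite scalerA mulVf ?scale1r.
Qed.
End ExteriorNormalForm.

Section NormalFormProjection.
Local Open Scope ring_scope.
Variables (F : fieldType) (a b : nat).
Local Notation L := 'I_(a + b).
Local Notation tensor := (tensor F a b).
Local Notation ext_ideal := (ext_ideal F a b).
Local Notation wtensor := (@wtensor F a b).

(** The normal-form projection. When 2 is invertible its kernel is exactly the ideal ([nproj_eq0]),
    so its image is a model of the super-exterior algebra in degree [k]. *)
Definition nproj k (u : tensor k) : tensor k :=
  \sum_(w : k.-tuple L) (u w * wsign F w) *: wtensor k (wsort w).

Lemma nproj_linear k : linear (@nproj k).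
Proof.
move=> c u v; rewrite scaler_sumr -big_split; apply: eq_bigr => w _ /=.
by rewrite !ffunE mulrDl scalerDl scalerA; congr (_ *: _ + _); rewrite mulrA.
Qed.

HB.instance Definition _ k :=
  GRing.isLinear.Build F (tensor k) (tensor k) _ (@nproj k) (@nproj_linear k).

Lemma nproj_wtensor k (w : seq L) :
  nproj (wtensor k w) = wsign F w *: wtensor k (wsort w).
Proof.
have [sz|sz] := eqVneq (size w) k; last first.
  by rewrite !wtensor_size ?size_sort // linear0 scaler0.
rewrite /nproj (bigD1 (Tuple (introT eqP sz))) //= !ffunE eqxx mul1r big1 ?addr0 //.
by move=> v vw; rewrite ffunE (negPf vw : (tval v == w) = false) mul0r scale0r.
Qed.

Lemma nproj_normal k (w : seq L) : normal_word w -> nproj (wtensor k w) = wtensor k w.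
Proof.
move=> nw; rewrite nproj_wtensor /wsign wsort_sorted ?nw; last exact: normal_sorted.
by rewrite inversions_sorted ?expr0 ?scale1r //; exact: normal_sorted.
Qed.

Lemma nproj_ideal k (u : tensor k) : u \in ext_ideal k -> nproj u = 0.
Proof.
suff /subvP h : (ext_ideal k <= lker (linfun (@nproj k)))%VS.
  by move/h; rewrite memv_ker lfunE => /eqP.
apply: ext_ideal_sub => p x y q; rewrite memv_ker lfunE /= /swap_rel.
rewrite linearD linearZ /= !nproj_wtensor scalerA wsort_swap -scalerDl.
by rewrite wsign_swap scale0r.
Qed.

Lemma nproj_congr k (u v : tensor k) : u - v \in ext_ideal k -> nproj u = nproj v.
Proof. by move/nproj_ideal/eqP; rewrite linearB subr_eq0 => /eqP. Qed.

Section CharNot2.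
Hypothesis two_neq0 : 2%:R != 0 :> F.

Lemma nproj_sub_ideal k (u : tensor k) : u - nproj u \in ext_ideal k.
Proof.
rewrite {1}[u]tensorE /nproj -sumrB; apply: memv_suml => w _.
rewrite -scalerA -scalerBr; apply: memvZ; exact: wtensor_sort.
Qed.

Lemma nproj_eq0 k (u : tensor k) : (nproj u == 0) = (u \in ext_ideal k).
Proof.
apply/eqP/idP => [u0|]; last exact: nproj_ideal.
by have := nproj_sub_ideal u; rewrite u0 subr0.
Qed.

(** A map preserving the ideals acts on the quotients, so its argument may first be put in normal
    form. *)
Lemma nproj_stable k l (f : {linear tensor k -> tensor l}) (u : tensor k) :
  {in ext_ideal k, forall v, f v \in ext_ideal l} ->
  nproj (f (nproj u)) = nproj (f u).
Proof.
move=> fI; apply/esym/nproj_congr; rewrite -linearB; apply: fI.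
exact: nproj_sub_ideal.
Qed.

End CharNot2.

Lemma nproj_supp k (u : tensor k) (v : k.-tuple L) : nproj u v != 0 -> normal_word v.
Proof.
apply: contraNT => nv; rewrite sum_ffunE big1 // => w _; rewrite !ffunE /wsign.
case: (tval v =P wsort w) nv => [<- /negPf->|_ _]; first by rewrite mulr0 scale0r.
by rewrite scaler0.
Qed.

Lemma nproj_sumE k (u : tensor k) :
  nproj u = \sum_(v : k.-tuple L | normal_word v) nproj u v *: wtensor k v.
Proof.
rewrite [LHS]tensorE [RHS]big_mkcond; apply: eq_bigr => v _.
by case: ifPn => // /(contraNT (@nproj_supp k u v))/eqP->; rewrite scale0r.
Qed.

End NormalFormProjection.

(** * Derivations of degree zero and weights *)

Section Derivations.
Local Open Scope ring_scope.
Variables (F : fieldType) (a b : nat).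
Local Notation L := 'I_(a + b).
Local Notation tensor := (tensor F a b).
Local Notation ext_ideal := (ext_ideal F a b).
Local Notation wtensor := (@wtensor F a b).
Implicit Types (w : seq L) (i j : L).

Lemma tbehead_linear k i : linear (@tbehead F a b k i).
Proof. by move=> c u v; apply/ffunP => w; rewrite !ffunE. Qed.

HB.instance Definition _ k i :=
  GRing.isLinear.Build F (tensor k.+1) (tensor k) _ (@tbehead F a b k i)
    (@tbehead_linear k i).

Lemma tbehead_lcons k i j (u : tensor k) : tbehead i (lcons j u) = (i == j)%:R *: u.
Proof.
apply/ffunP => w; rewrite !ffunE theadE; congr (_ * u _); exact: val_inj.
Qed.

(* Row [i] of [M] is the image of [x_i^*]. *)
Fixpoint tder (M : 'M[F]_(a + b)) k : tensor k -> tensor k :=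
  if k is k'.+1 return tensor k -> tensor k then
    fun u => \sum_i (\sum_j M i j *: lcons j (tbehead i u)
                     + lcons i (tder M (tbehead i u)))
  else fun=> 0.

Lemma tder_linear M k : linear (@tder M k).
Proof.
elim: k => [|k IHk] c u v /=; first by rewrite scaler0 addr0.
rewrite scaler_sumr -big_split /=; apply: eq_bigr => i _.
rewrite linearP IHk linearP scalerDr addrACA; congr (_ + _).
rewrite scaler_sumr -big_split; apply: eq_bigr => j _ /=.
by rewrite linearP scalerDr !scalerA [c * _]mulrC.
Qed.

HB.instance Definition _ M k :=
  GRing.isLinear.Build F (tensor k) (tensor k) _ (@tder M k) (@tder_linear M k).

Lemma tder0 M (u : tensor 0) : tder M u = 0. Proof. by []. Qed.

Lemma tderS M k (u : tensor k.+1) :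
  tder M u = \sum_i (\sum_j M i j *: lcons j (tbehead i u)
                     + lcons i (tder M (tbehead i u))).
Proof. by []. Qed.

Opaque tder.

Lemma tder_lcons M k i (u : tensor k) :
  tder M (lcons i u) = \sum_j M i j *: lcons j u + lcons i (tder M u).
Proof.
rewrite tderS (bigD1 i) //= tbehead_lcons eqxx scale1r.
rewrite [X in _ + X = _]big1 ?addr0 // => j ji.
rewrite tbehead_lcons (negPf ji) scale0r !linear0 addr0 big1 // => l _.
by rewrite linear0 scaler0.
Qed.

Lemma lcons_swap_ideal k x y (u : tensor k) :
  lcons x (lcons y u) + (-1) ^+ (odd_idx x * odd_idx y) *: lcons y (lcons x u)
    \in ext_ideal k.+2.
Proof.
rewrite [u]tensorE !linear_sum /= -big_split; apply: memv_suml => w _ /=.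
rewrite !linearZ /= -scalerDr !lcons_wtensor; apply: memvZ.
exact: (swap_rel_ideal _ _ [::]).
Qed.

(** By the Leibniz rule, deriving a relation gives relations in which one of the two letters is
    replaced by letters of its image; the sign stays right because [M] preserves parity. *)
Lemma tder_ideal (M : 'M[F]_(a + b)) k :
  (forall i j, M i j != 0 -> odd_idx i = odd_idx j) ->
  {in ext_ideal k, forall u, tder M u \in ext_ideal k}.
Proof.
move=> Mpar; apply: ext_ideal_stable => p x y q /=.
elim: p k => [|i p IH] [|k]; try by rewrite tder0 mem0v.
- case: k => [|k].
    by rewrite /swap_rel !wtensor_size // scaler0 addr0 linear0 mem0v.
  rewrite /swap_rel /= -!lcons_wtensor; move: (wtensor k q) => {q} u.
  rewrite linearD linearZ /= !tder_lcons !linearD !linear_sum /=.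
  set e := _ ^+ _; rewrite [X in _ + X]addrCA addrACA [X in _ + X]addrACA.
  apply: rpredD; last apply: rpredD; last exact: lcons_swap_ideal.
    rewrite -big_split; apply: memv_suml => j _ /=.
    have [->|/Mpar xj] := eqVneq (M x j) 0.
      by rewrite !linearZ /= !scale0r addr0 mem0v.
    rewrite !linearZ /= -scalerDr /e xj; apply: memvZ; exact: lcons_swap_ideal.
  rewrite -big_split; apply: memv_suml => j _ /=.
  have [->|/Mpar yj] := eqVneq (M y j) 0.
    by rewrite !linearZ /= !scale0r addr0 mem0v.
  rewrite !linearZ /= -scalerDr /e yj; apply: memvZ; exact: lcons_swap_ideal.
- rewrite /swap_rel /= -!lcons_wtensor -linearZ -linearD tder_lcons.
  apply: rpredD; last by apply: lcons_ideal; exact: IH.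
  apply: memv_suml => j _; apply: memvZ; apply: lcons_ideal; exact: swap_rel_ideal.
Qed.

(** In the row convention, [tder M] followed by [tder M'] acts on letters as [M *m M']. The terms in
    which the two derivations hit different letters are symmetric in [M] and [M'] and cancel. *)
Lemma tder_comm M M' k (u : tensor k) :
  tder M' (tder M u) - tder M (tder M' u) = tder (M *m M' - M' *m M) u.
Proof.
elim: k u => [|k IH] u; first by rewrite !tder0 subr0.
have comp (A B : 'M[F]_(a + b)) i (v : tensor k) : tder B (tder A (lcons i v)) =
    (\sum_j (A *m B) i j *: lcons j v + lcons i (tder B (tder A v)))
    + (\sum_j A i j *: lcons j (tder B v) + \sum_j B i j *: lcons j (tder A v)).
  rewrite tder_lcons linearD linear_sum /= tder_lcons.
  rewrite [in RHS]addrACA [X in _ = _ + X]addrC; congr (_ + _).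
  have -> : \sum_j (A *m B) i j *: lcons j v =
      \sum_j A i j *: (\sum_l B j l *: lcons l v).
    under [RHS]eq_bigr do rewrite scaler_sumr.
    rewrite exchange_big; apply: eq_bigr => l _; rewrite mxE scaler_suml.
    by apply: eq_bigr => j _; rewrite scalerA.
  rewrite -big_split; apply: eq_bigr => j _ /=.
  by rewrite linearZ /= tder_lcons scalerDr.
have [f ->] : exists f, u = \sum_i lcons i (f i).
  by exists (fun i => tbehead i u); exact: tensor_lconsE.
rewrite (linear_sum (@tder M k.+1)) (linear_sum (@tder M' k.+1)).
rewrite (linear_sum (@tder M' k.+1)) (linear_sum (@tder M k.+1)).
rewrite (linear_sum (@tder _ k.+1)) -sumrB; apply: eq_bigr => i _.
rewrite -[LHS]/(tder M' (tder M (lcons i (f i))) - tder M (tder M' (lcons i (f i)))).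
rewrite -[RHS]/(tder (M *m M' - M' *m M) (lcons i (f i))).
rewrite !comp tder_lcons [X in _ - (_ + X)]addrC opprD addrACA subrr addr0.
rewrite opprD addrACA -linearB IH -sumrB; congr (_ + _).
by apply: eq_bigr => j _; rewrite !mxE scalerBl.
Qed.

Lemma tder_diag (d : 'rV[F]_(a + b)) k (w : seq L) :
  tder (diag_mx d) (wtensor k w) = (\sum_(i <- w) d 0 i) *: wtensor k w.
Proof.
elim: w k => [|i w IH] [|k]; try by rewrite wtensor_size // linear0 scaler0.
  by rewrite tder0 big_nil scale0r.
rewrite -lcons_wtensor tder_lcons IH big_cons scalerDl linearZ /=; congr (_ + _).
rewrite (bigD1 i) //= mxE eqxx mulr1n big1 ?addr0 // => j ji.
by rewrite mxE eq_sym (negPf ji) scale0r.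
Qed.

Section Weights.
Variable wt : L -> int.

Definition wweight (w : seq L) : int := \sum_(i <- w) wt i.

Definition homog_tensor k (mu : int) (u : tensor k) :=
  forall w : k.-tuple L, u w != 0 -> wweight w = mu.

Lemma homog_sum k mu (I : finType) (f : I -> tensor k) :
  (forall s, homog_tensor mu (f s)) -> homog_tensor mu (\sum_s f s).
Proof.
move=> fh w; rewrite sum_ffunE => nz.
have [s fs] : exists s, f s w != 0.
  apply/existsP; apply: contra_neqT nz => /existsPn nz.
  by rewrite big1 // => s _; have := nz s; rewrite negbK => /eqP.
exact: fh fs.
Qed.

Lemma homogD k mu (u v : tensor k) :
  homog_tensor mu u -> homog_tensor mu v -> homog_tensor mu (u + v).
Proof.
move=> hu hv w; rewrite ffunE; have [uw|/hu //] := eqVneq (u w) 0.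
by rewrite uw add0r => /hv.
Qed.

Lemma homogZ k mu c (u : tensor k) : homog_tensor mu u -> homog_tensor mu (c *: u).
Proof. by move=> hu w; rewrite ffunE mulf_eq0 negb_or => /andP[_ /hu]. Qed.

Lemma homog_wtensor k (w : seq L) : homog_tensor (wweight w) (wtensor k w).
Proof. by move=> v; rewrite ffunE; case: (tval v =P w) => [<- //|_]; rewrite eqxx. Qed.

Lemma homog_lcons k mu nu i (u : tensor k) : homog_tensor mu u -> nu = mu + wt i ->
  homog_tensor nu (lcons i u).
Proof.
move=> hu ->; case/tupleP => x v; rewrite ffunE theadE.
have [<-|_] := eqVneq x i; last by rewrite mul0r eqxx.
rewrite mul1r => /hu /= h; rewrite /wweight big_cons addrC; congr (_ + _).
by rewrite -h.
Qed.

Lemma homog_tbehead k mu i (u : tensor k.+1) : homog_tensor mu u ->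
  homog_tensor (mu - wt i) (tbehead i u).
Proof.
by move=> hu w; rewrite ffunE => /hu <-; rewrite /wweight /= big_cons addrC addKr.
Qed.

Lemma homog_tder (M : 'M[F]_(a + b)) (d : int) k mu (u : tensor k) :
  (forall i j, M i j != 0 -> wt j = wt i + d) ->
  homog_tensor mu u -> homog_tensor (mu + d) (tder M u).
Proof.
move=> hM; elim: k mu u => [|k IH] mu u hu.
  by rewrite tder0 => w; rewrite ffunE eqxx.
rewrite tderS.
apply: homog_sum => i; apply: homogD; last first.
  by apply: (homog_lcons (IH _ _ (homog_tbehead hu))); ring.
apply: homog_sum => j; have [->|/hM wj] := eqVneq (M i j) 0.
  by rewrite scale0r => w; rewrite ffunE eqxx.
by apply/homogZ/(homog_lcons (homog_tbehead hu)); rewrite wj; ring.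
Qed.

(** Sorting only permutes the letters of a word. *)
Lemma homog_nproj k mu (u : tensor k) : homog_tensor mu u -> homog_tensor mu (nproj u).
Proof.
move=> hu; apply: homog_sum => w; have [->|/hu <-] := eqVneq (u w) 0.
  by rewrite mul0r scale0r => v; rewrite ffunE eqxx.
apply: homogZ; rewrite /wweight -(perm_big _ (permEl (perm_sort (@wle a b) w))).
exact: homog_wtensor.
Qed.
End Weights.
End Derivations.

(** * Cohomology dimensions *)

Section CohomologyDimension.
Local Open Scope ring_scope.
Variables (F : fieldType) (a b : nat) (g : lieSuperalgebra F a b).
Hypothesis two_neq0 : 2%:R != 0 :> F.
Local Notation L := 'I_(a + b).
Local Notation tensor := (tensor F a b).
Local Notation ext_ideal := (ext_ideal F a b).
Local Notation wtensor := (@wtensor F a b).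

Definition normal_set k : {set k.-tuple L} := [set w : k.-tuple L | normal_word w].

(** The rank of the differential induced on the super-exterior algebra, read in normal forms. *)
Definition diff_rank k :=
  \dim (limg (linfun (@nproj F a b k.+1) \o linfun (@diff F a b g k))).

Lemma wtensor_free k q (f : 'I_q -> k.-tuple L) (c : 'I_q -> F) : injective f ->
  \sum_j c j *: wtensor k (f j) = 0 -> forall j, c j = 0.
Proof.
move=> finj /ffunP sum0 j; have := sum0 (f j).
rewrite sum_ffunE (bigD1 j) //= wtensor_tuple !ffunE eqxx big1.
  by rewrite addr0 [_ *: _]mulr1.
move=> i ij; rewrite wtensor_tuple !ffunE eq_sym (inj_eq finj) (negPf ij).
exact: mulr0.
Qed.

Lemma lker_nproj k : lker (linfun (@nproj F a b k)) = ext_ideal k.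
Proof. by apply/vspaceP => u; rewrite memv_ker lfunE nproj_eq0. Qed.

Lemma dim_limg_nproj k : \dim (limg (linfun (@nproj F a b k))) = #|normal_set k|.
Proof.
pose gN (j : 'I_#|normal_set k|) := wtensor k (enum_val j).
have gfree c : \sum_j c j *: gN j = 0 -> forall j, c j = 0.
  by apply: wtensor_free; exact: enum_val_inj.
rewrite -[RHS](mxrank1 F) -(dim_span_mx 1%:M gfree); congr (\dim _).
have rowE i : \sum_j 1%:M i j *: gN j = gN i.
  rewrite (bigD1 i) //= mxE eqxx scale1r big1 ?addr0 // => j ji.
  by rewrite mxE eq_sym (negPf ji) scale0r.
under [RHS]eq_bigr do rewrite rowE.
apply/eqP; rewrite eqEsubv; apply/andP; split.
  apply/subvP => _ /memv_imgP[u _ ->]; rewrite lfunE /= nproj_sumE.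
  apply: memv_suml => v nv; apply: memvZ.
  have vN : v \in normal_set k by rewrite inE.
  rewrite -(enum_rankK_in vN vN); apply: (subvP (sumv_sup _ _ (subvv _))) => //.
  exact: memv_line.
apply/subv_sumP => i _; rewrite -memvE.
have gNi : nproj (gN i) = gN i.
  by apply: nproj_normal; have := enum_valP i; rewrite inE.
by rewrite -gNi -[nproj _](lfunE (@nproj F a b k)) memv_img ?memvf.
Qed.

Lemma dim_ideal k : (\dim (ext_ideal k) + #|normal_set k|)%N = \dim {:tensor k}.
Proof.
by rewrite -dim_limg_nproj -lker_nproj -[X in (\dim X + _)%N]capfv limg_ker_dim.
Qed.

(** Rank-nullity for the normal form of the differential, whose kernel is the space of cocycles. *)
Lemma dim_cocycles k : (\dim (cocycles g k) + diff_rank k)%N = \dim {:tensor k}.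
Proof.
rewrite -(limg_ker_dim (linfun (@nproj F a b k.+1) \o linfun (@diff F a b g k)) fullv).
congr (\dim _ + _)%N; apply/vspaceP => u.
by rewrite capfv -memv_preim memv_ker comp_lfunE !lfunE nproj_eq0.
Qed.

(** Rank-nullity for [nproj] restricted to the coboundaries: its kernel is the ideal, and its image
    is that of the induced differential. *)
Lemma dim_coboundaries k :
  \dim (coboundaries g k.+1) = (\dim (ext_ideal k.+1) + diff_rank k)%N.
Proof.
rewrite -(limg_ker_dim (linfun (@nproj F a b k.+1)) (coboundaries g k.+1)).
rewrite lker_nproj (capv_idPr (addvSr _ _)) /=; congr (_ + \dim _)%N.
have ideal0 : (linfun (@nproj F a b k.+1) @: ext_ideal k.+1 = 0)%VS.
  by apply/eqP; rewrite -lkerE lker_nproj subvv.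
by rewrite limgD ideal0 addv0 -limg_comp.
Qed.

Lemma dim_cohomology0 : dim_cohomology g 0 = (#|normal_set 0| - diff_rank 0)%N.
Proof.
rewrite /dim_cohomology; have := dim_cocycles 0; have := dim_ideal 0 => /=; lia.
Qed.

Lemma dim_cohomologyS k :
  dim_cohomology g k.+1 = (#|normal_set k.+1| - diff_rank k.+1 - diff_rank k)%N.
Proof.
rewrite /dim_cohomology dim_coboundaries.
have := dim_cocycles k.+1; have := dim_ideal k.+1; lia.
Qed.
End CohomologyDimension.

(** * The differential of the model filiform superalgebra *)

Section FiliformDifferential.
Local Open Scope ring_scope.
Variables (F : fieldType) (n m : nat).
Local Notation L := 'I_(n.+1 + m).
Local Notation tensor := (tensor F n.+1 m).
Local Notation g := (model_filiform F n m).
Implicit Types i j l : L.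

Definition X0 : L := lshift m ord0.

(** The transpose of bracketing with X_0: each dual letter goes to that of its predecessor, and
    those of X_0, X_1 and Y_1 go to zero. *)
Definition lower_mx : 'M[F]_(n.+1 + m) := \matrix_(i, j) (filiform_succ j i)%:R.

Lemma filiform_constE k l i : struct_const g k l i = filiform_const F k l i.
Proof.
rewrite /struct_const /= mxE (bigD1 k) //= (bigD1 l) //= !mxE !eqxx !mul1r.
rewrite big1 ?addr0 => [|l' /negPf l'l]; last by rewrite !mxE l'l andbF mulr0 mul0r.
rewrite big1 ?addr0 // => k' /negPf k'k; rewrite big1 // => l' _.
by rewrite !mxE k'k andbF !mul0r.
Qed.

Lemma tmul_dual k i (u : tensor k) : tmul (dual F i) u = lcons i u.
Proof.
apply/ffunP => w; rewrite !ffunE.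
have -> : [tuple tnth w (lshift k s) | s < 1] = [tuple thead w].
  apply: eq_from_tnth => s; rewrite tnth_mktuple ord1 [RHS]/=.
  by congr tnth; apply: val_inj.
have -> : [tuple tnth w (rshift 1 t) | t < k] = [tuple of behead w].
  apply: eq_from_tnth => t; rewrite tnth_mktuple tnth_behead; congr tnth.
  by apply: val_inj; rewrite /= inordK // ltnS.
by congr (_%:R * _); rewrite -val_eqE /= eqseq_cons eqxx andbT.
Qed.

Lemma tmul_lcons p q i (u : tensor p) (v : tensor q) :
  tmul (lcons i u) v = lcons i (tmul u v) :> tensor (p + q).+1.
Proof.
apply/ffunP => w; rewrite !ffunE mulrA; congr (_%:R * u _ * v _).
- by congr (_ == _); rewrite /thead tnth_mktuple; congr tnth; apply: val_inj.
- apply: eq_from_tnth => t; rewrite tnth_behead !tnth_mktuple tnth_behead; congr tnth.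
  by apply: val_inj; rewrite /= !inordK // ?ltnS //= ltn_addr.
- apply: eq_from_tnth => t; rewrite !tnth_mktuple tnth_behead; congr tnth.
  by apply: val_inj; rewrite /= inordK // ltnS ltn_add2l.
Qed.

Lemma tmul_suml p q (I : finType) (f : I -> tensor p) (v : tensor q) :
  tmul (\sum_s f s) v = \sum_s tmul (f s) v.
Proof.
apply/ffunP => w; rewrite ffunE !sum_ffunE mulr_suml.
by apply: eq_bigr => s _; rewrite ffunE.
Qed.

Lemma tmulZl p q c (u : tensor p) (v : tensor q) : tmul (c *: u) v = c *: tmul u v.
Proof. by apply/ffunP => w; rewrite !ffunE -mulrA. Qed.

(** Among the brackets of a basis vector with a later one, only those starting with X_0 can be
    nonzero, and brackets of an odd basis vector with itself vanish. *)
Lemma diff_dualE i :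
  diff_dual g i = \sum_l lower_mx i l *: (lcons X0 (dual F l) : tensor 2).
Proof.
rewrite /diff_dual [X in _ - _ *: X]big1 => [|k _]; last first.
  by rewrite filiform_constE /filiform_const subrr scale0r.
rewrite scaler0 subr0 (bigD1 X0) //= [X in _ + X]big1 => [|k kX0]; last first.
  rewrite big1 // => l kl; rewrite filiform_constE /filiform_const.
  have -> : (k == 0%N :> nat) = false.
    by apply/negP => /eqP k0; case/eqP: kX0; apply: val_inj.
  by rewrite (gtn_eqF (leq_ltn_trans (leq0n k) kl)) subrr mulr0 scale0r.
rewrite addr0 big_mkcond; apply: eq_bigr => l _; rewrite tmul_dual !mxE.
rewrite filiform_constE /filiform_const /filiform_succ /= expr0 mul1r andbF subr0.
by case: (posnP l) => [->|_]; rewrite ?ltnn ?scale0r.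
Qed.

(** As X_0 is even, moving x_i^* past X_0^* costs a sign -1, which cancels the sign in the graded
    Leibniz rule for [diff]. *)
Lemma diff_lower k (u : tensor k) :
  diff g u - lcons X0 (tder lower_mx u) \in ext_ideal F n.+1 m k.+1.
Proof.
elim: k u => [|k IH] u; first by rewrite tder0 linear0 subr0 mem0v.
rewrite tderS linear_sum /= -sumrB; apply: memv_suml => i _.
move: (tbehead i u) => {}u; rewrite tmul_dual.
have -> : tmul (diff_dual g i) u = \sum_l lower_mx i l *: lcons X0 (lcons l u).
  rewrite diff_dualE tmul_suml; apply: eq_bigr => l _.
  rewrite -(tmul_dual l); apply: etrans (tmulZl _ _ _) _.
  congr (_ *: _); exact: (@tmul_lcons 1 k X0 (dual F l) u).
rewrite linearD linear_sum /= [X in _ - (X + _)](eq_bigr _ (fun l _ => linearZ _ _)) /=.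
rewrite opprD addrACA subrr add0r -opprD rpredN.
have := lcons_ideal i (IH u); have := lcons_swap_ideal X0 i (tder lower_mx u).
rewrite (_ : odd_idx X0 = false) // mul0n expr0 scale1r linearB /= => h1 h2.
rewrite (_ : _ + _ = (lcons i (diff g u) - lcons i (lcons X0 (tder lower_mx u)))
   + (lcons X0 (lcons i (tder lower_mx u)) + lcons i (lcons X0 (tder lower_mx u)))).
  exact: rpredD.
by rewrite addrACA [- _ + _]addrC subrr addr0 addrC.
Qed.
End FiliformDifferential.

(** * Rank of the differential of the model filiform superalgebra *)

Section FiliformRank.
Local Open Scope ring_scope.
Variables (F : fieldType) (n m : nat).
Hypothesis charF : [pchar F] =i pred0.
Local Notation L := 'I_(n.+1 + m).
Local Notation tensor := (tensor F n.+1 m).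
Local Notation wtensor := (@wtensor F n.+1 m).
Local Notation g := (model_filiform F n m).
Local Notation X0 := (X0 n m).
Local Notation lower_mx := (lower_mx F n m).
Implicit Types i j l : L.

(* [X_i] has weight [2 i - (n + 1)] and [Y_j] has weight [2 j - (m + 1)]. *)
Definition letter_weight i : int :=
  if i == 0%N :> nat then 0
  else if (i <= n)%N then i%:Z *+ 2 - n.+1%:Z else (i - n)%N%:Z *+ 2 - m.+1%:Z.

(** The coefficients i (n - i) and j (m - j) of the standard raising operators on the irreducible
    sl_2-modules of dimensions n and m spanned by the X_i and the Y_j with positive index; they
    vanish at the top letters X_n and Y_m. *)
Definition raise_coef (i : nat) : nat :=
  if (i <= n)%N then (i * (n - i))%N else ((i - n) * (m - (i - n)))%N.

Definition raise_mx : 'M[F]_(n.+1 + m) :=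
  \matrix_(i, j) ((raise_coef i)%:R * (filiform_succ i j)%:R).

Lemma succ_weight i j : filiform_succ i j -> letter_weight j = letter_weight i + 2.
Proof.
rewrite /filiform_succ /letter_weight => /and3P[i0 iN /eqP ji].
rewrite ji /= (gtn_eqF i0) ltn_neqAle iN /=; case: ltnP => iltn; lia.
Qed.

Lemma lower_mx_neq0 i j : lower_mx i j != 0 -> filiform_succ j i.
Proof. by rewrite mxE; case: filiform_succ; rewrite // eqxx. Qed.

Lemma raise_mx_neq0 i j : raise_mx i j != 0 -> filiform_succ i j.
Proof. by rewrite mxE; case: filiform_succ; rewrite // mulr0 eqxx. Qed.

Lemma succ_odd i j : filiform_succ i j -> odd_idx i = odd_idx j.
Proof.
by case/and3P => _ iN /eqP ji; rewrite /odd_idx ji ltnS ltn_neqAle eq_sym iN.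
Qed.

Lemma succ_neq0 i j : filiform_succ i j -> (i != X0) && (j != X0).
Proof.
by case/and3P => i0 _ /eqP ji; rewrite -!val_eqE /= ji -lt0n i0.
Qed.

Lemma lower_mx_X0 i j : lower_mx i j != 0 -> (i != X0) && (j != X0).
Proof. by move/lower_mx_neq0/succ_neq0; rewrite andbC. Qed.

Lemma raise_mx_X0 i j : raise_mx i j != 0 -> (i != X0) && (j != X0).
Proof. by move/raise_mx_neq0/succ_neq0. Qed.

Lemma lower_mx_odd i j : lower_mx i j != 0 -> odd_idx i = odd_idx j.
Proof. by move/lower_mx_neq0/succ_odd. Qed.

Lemma raise_mx_odd i j : raise_mx i j != 0 -> odd_idx i = odd_idx j.
Proof. by move/raise_mx_neq0/succ_odd. Qed.

(** Both products are diagonal because the successor relation is a partial injection. On X_i with i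
    positive the difference is i (n - i) - (i - 1)(n - i + 1) = n + 1 - 2 i, and likewise on Y_j
    with m. *)
Lemma raise_lower_comm :
  raise_mx *m lower_mx - lower_mx *m raise_mx
    = diag_mx (\row_i - (letter_weight i)%:~R).
Proof.
have succ_inj i j l : filiform_succ i l -> filiform_succ j l = (i == j).
  case/and3P=> i0 iN /eqP li; rewrite /filiform_succ li eqSS.
  rewrite -val_eqE /= andbA; case: (i =P j :> nat) => [<-|_]; last by rewrite !andbF.
  by rewrite i0 iN.
have succ_fun i j l : filiform_succ l i -> filiform_succ l j = (i == j).
  case/and3P=> l0 lN /eqP il; rewrite /filiform_succ l0 lN /= -il.
  by rewrite eq_sym val_eqE.
have EDij i j : (raise_mx *m lower_mx) i j = ((i == j) * raise_coef i)%:R.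
  rewrite mxE; case: (pickP (filiform_succ i)) => [l il|noS].
    rewrite (bigD1 l) //= !mxE il (succ_inj _ j _ il) mulr1 big1 ?addr0.
      by rewrite mulnC natrM.
    move=> l'; rewrite !mxE (succ_fun _ l' _ il) eq_sym => /negPf->.
    by rewrite mulr0 mul0r.
  rewrite big1 => [|l _]; last by rewrite !mxE noS mulr0 mul0r.
  suff -> : raise_coef i = 0%N by rewrite muln0.
  have iL : (i < n.+1 + m)%N := ltn_ord i; rewrite /raise_coef.
  have [i0|i0] := posnP i; first by rewrite i0.
  have [->|iN] := eqVneq (val i) n; first by rewrite leqnn subnn muln0.
  have [i1|i1] := ltnP i.+1 (n.+1 + m).
    by have := noS (Ordinal i1); rewrite /filiform_succ i0 iN /= eqxx.
  case: leqP => in'; lia.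
(* The guard selects the letters that have a predecessor: X_0, X_1 and Y_1, the last of index n + 1,
   have none. *)
have DEij i j : (lower_mx *m raise_mx) i j =
    ((i == j) * (if (1 < i)%N && (i != n.+1 :> nat) then raise_coef i.-1 else 0))%:R.
  rewrite mxE; case: (pickP (fun l => filiform_succ l i)) => [l il|noP].
    rewrite (bigD1 l) //= !mxE il (succ_fun _ j _ il) mul1r big1 ?addr0.
      case/and3P: il => l0 lN /eqP ->; rewrite ltnS l0 eqSS lN /=.
      by rewrite mulnC natrM.
    move=> l'; rewrite !mxE (succ_inj _ l' _ il) eq_sym => /negPf->.
    by rewrite mul0r.
  rewrite big1 => [|l _]; last by rewrite !mxE noP mul0r.
  case: ifP => [/andP[i1 iN]|]; rewrite ?muln0 //.
  have iL : (i.-1 < n.+1 + m)%N := leq_ltn_trans (leq_pred i) (ltn_ord i).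
  have := noP (Ordinal iL); rewrite /filiform_succ /= prednK ?eqxx ?(ltnW i1) //.
  by rewrite -ltnS prednK ?(ltnW i1) // i1 -eqSS prednK ?(ltnW i1) // iN.
apply/matrixP => i j; rewrite [LHS]mxE [X in _ + X]mxE EDij DEij !mxE.
have [_|_] := eqVneq i j; last by rewrite !mul0n subrr mulr0n.
rewrite !mul1n mulr1n !pmulrn -rmorphB -rmorphN /=; congr (intmul 1 _).
have iL := ltn_ord i; rewrite /raise_coef /letter_weight.
move: (i : nat) iL => {i j} [|v] vL; first by rewrite /= mul0n.
rewrite !ltnS !eqSS /=; case: ltnP => [vn|nv].
  (* Writing the larger numbers as sums removes truncated subtractions before the polynomial
     identity. *)
  have [d ->] : exists d, n = (v.+1 + d)%N by exists (n - v.+1)%N; lia.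
  have [-> ->] : (v != (v.+1 + d)%N) = true /\ (v <= v.+1 + d)%N = true.
    by split; lia.
  by case: (posnP v) => [->|v0]; rewrite /=; nia.
have [e ve] : exists e, v = (n + e)%N by exists (v - n)%N; lia.
have [d ->] : exists d, m = (e.+1 + d)%N by exists (m - e.+1)%N; lia.
have [-> ->] : (v.+1 - n = e.+1 /\ v - n = e)%N by lia.
have [-> ->] : (e.+1 + d - e.+1 = d /\ e.+1 + d - e = d.+1)%N by lia.
case: (posnP e) => [e0|e0].
  by rewrite ve e0 addn0 eqxx andbF; lia.
have [-> [-> ->]] : (0 < v)%N = true /\ (v != n) = true /\ (v <= n)%N = false.
  by split; [|split]; lia.
by rewrite /=; nia.
Qed.

(** [X0] is the least letter and is even, so it can occur only once, in first position. *)
Lemma normal_cons_X0 (w : seq L) :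
  normal_word (X0 :: w) = normal_word w && (X0 \notin w).
Proof.
rewrite /normal_word /= (path_sortedE (@normal_step_trans _ _)) andbC; congr (_ && _).
rewrite -has_pred1 -all_predC; apply: eq_all => y.
by rewrite /normal_step andbF orbF /= lt0n.
Qed.

Lemma normal_X0_head (w : seq L) : normal_word w -> X0 \in w -> w = X0 :: behead w.
Proof.
move=> /normal_sorted; case: w => // x w /=.
rewrite (path_sortedE (@wle_trans _ _)) inE => /andP[/allP xw _].
case/orP => [/eqP -> //|/xw]; rewrite /wle /= leqn0 => /eqP x0.
by congr cons; apply: val_inj.
Qed.

Definition free_set k : {set k.-tuple L} :=
  [set w : k.-tuple L | normal_word w && (X0 \notin tval w)].

Definition fword k (s : 'I_#|free_set k|) : k.-tuple L := enum_val s.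

Lemma fwordP k (s : 'I_#|free_set k|) :
  normal_word (fword s) && (X0 \notin tval (fword s)).
Proof. by have := enum_valP s; rewrite inE. Qed.

Definition tder_mx k (M : 'M[F]_(n.+1 + m)) : 'M[F]_#|free_set k| :=
  \matrix_(s, t) nproj (tder M (wtensor k (fword s))) (fword t).

Lemma wweight_X0 (w : seq L) : wweight (fun i => (i == X0)%:Z) w = (count_mem X0 w)%:Z.
Proof.
elim: w => [|i w IH]; rewrite /wweight ?big_nil // big_cons.
by rewrite -/(wweight _ w) IH.
Qed.

(** The number of occurrences of [X0] is used as a weight: [M] neither consumes nor produces [X0],
    so only words free of it appear. *)
Lemma nproj_tder_free k (M : 'M[F]_(n.+1 + m)) (s : 'I_#|free_set k|) :
  (forall i j, M i j != 0 -> (i != X0) && (j != X0)) ->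
  nproj (tder M (wtensor k (fword s)))
    = \sum_t tder_mx k M s t *: wtensor k (fword t).
Proof.
move=> MX0; rewrite nproj_sumE; under [RHS]eq_bigr do rewrite mxE.
set u := nproj _.
rewrite -(big_enum_val (fun v : k.-tuple L => u v *: wtensor k v)) /=.
rewrite big_mkcond [RHS]big_mkcond; apply: eq_bigr => v _; rewrite inE.
case: (normal_word v) => //=; case: ifPn => //; rewrite negbK => Xv.
suff /eqP-> : u v == 0 by rewrite scale0r.
apply: contraLR Xv => uv; rewrite -has_pred1 has_count -leqNgt leqn0.
have h0 : homog_tensor (fun i => (i == X0)%:Z) 0 (wtensor k (fword s)).
  have := @homog_wtensor F _ _ (fun i => (i == X0)%:Z) k (fword s).
  rewrite wweight_X0 (_ : count_mem X0 _ = 0%N) //; apply/count_memPn.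
  by case/andP: (fwordP s).
have /homog_nproj/(_ v uv) : 
    homog_tensor (fun i => (i == X0)%:Z) (0 + 0) (tder M (wtensor k (fword s))).
  apply: homog_tder h0 => {}i j /MX0/andP[/negPf-> /negPf->]; by rewrite addr0.
by rewrite wweight_X0 addr0 => /eqP.
Qed.

Section TwoLetterMaps.
Variables A B : 'M[F]_(n.+1 + m).
Hypothesis A_X0 : forall i j, A i j != 0 -> (i != X0) && (j != X0).
Hypothesis B_odd : forall i j, B i j != 0 -> odd_idx i = odd_idx j.

Lemma two_neq0 : 2%:R != 0 :> F.
Proof. by move/pcharf0P: charF => ->. Qed.

Lemma tder_mx_mul k (s t : 'I_#|free_set k|) :
  (tder_mx k A *m tder_mx k B) s t =
  nproj (tder B (tder A (wtensor k (fword s)))) (fword t).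
Proof.
rewrite -(nproj_stable two_neq0 _ (tder_ideal B_odd)) nproj_tder_free //.
rewrite !linear_sum sum_ffunE mxE; apply: eq_bigr => r _.
by rewrite [tder_mx k B r t]mxE !linearZ ffunE.
Qed.
End TwoLetterMaps.

Definition word_weight k (s : 'I_#|free_set k|) : int :=
  wweight letter_weight (fword s).

Lemma tder_mx_shift k (M : 'M[F]_(n.+1 + m)) (d : int) : 
  (forall i j, M i j != 0 -> letter_weight j = letter_weight i + d) ->
  shifts_weight (@word_weight k) d (tder_mx k M).
Proof.
move=> hM s t; rewrite mxE; apply: homog_nproj; apply: homog_tder hM _.
exact: homog_wtensor.
Qed.

Definition middle_set k : {set k.-tuple L} :=
  [set w in free_set k | (wweight letter_weight (tval w) == 0)
                         || (wweight letter_weight (tval w) == -1)].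

(** The relation between letters passes to derivations by [tder_comm], and the diagonal derivation
    multiplies a word by minus its total weight; this is the commutation required by
    [rank_lowering]. *)
Lemma rank_tder_lower k :
  (\rank (tder_mx k lower_mx) + #|middle_set k|)%N = #|free_set k|.
Proof.
apply: etrans (rank_lowering charF (h := @word_weight k) (D := tder_mx k lower_mx)
  (E := tder_mx k raise_mx) _ _ _).
- congr (_ + _)%N; rewrite -[RHS]sum1_card -sum1_card /=.
  rewrite -(big_enum_val_cond (fun w => (wweight letter_weight (tval w) == 0)
    || (wweight letter_weight (tval w) == -1)) (fun=> 1%N)) /=.

  by apply: eq_bigl => w; rewrite !inE.
- by apply: tder_mx_shift => i j /lower_mx_neq0/succ_weight->; rewrite addrK.
- by apply: tder_mx_shift => i j /raise_mx_neq0/succ_weight.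
apply/matrixP => s t; rewrite [RHS]mxE [X in _ = _ + X]mxE.
rewrite (tder_mx_mul raise_mx_X0 lower_mx_odd) (tder_mx_mul lower_mx_X0 raise_mx_odd).
apply/eqP; rewrite addrC -subr_eq; apply/eqP.
set u := wtensor k _.
have -> : (nproj (tder lower_mx (tder raise_mx u)) (fword t)
    - nproj (tder raise_mx (tder lower_mx u)) (fword t)) = 
  nproj (tder lower_mx (tder raise_mx u) - tder raise_mx (tder lower_mx u)) (fword t).
  by rewrite linearB !ffunE.
rewrite tder_comm raise_lower_comm tder_diag linearZ /= nproj_normal; last first.
  by case/andP: (fwordP s).
rewrite wtensor_tuple !ffunE !mxE /word_weight /wweight.
rewrite (inj_eq enum_val_inj) eq_sym; case: eqP => _; last first.
  by rewrite mulr0n oppr0 [LHS]mulr0.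
rewrite mulr1n [LHS]mulr1 -rmorphN -sumrN rmorph_sum; apply: eq_bigr => i _.
by rewrite mxE rmorphN.
Qed.

(** D kills [X0], so the result begins with [X0] twice; the square of an even letter is zero as 2 is
    invertible. *)
Lemma lcons_tder_X0 k (w : seq L) : normal_word w -> X0 \in w ->
  lcons X0 (tder lower_mx (wtensor k w)) \in ext_ideal F n.+1 m k.+1.
Proof.
move=> nw Xw; rewrite (normal_X0_head nw Xw).
case: k => [|k]; first by rewrite tder0 linear0 mem0v.
rewrite -lcons_wtensor tder_lcons big1 ?add0r => [|j _]; last first.
  by rewrite mxE /filiform_succ !andbF scale0r.
have := lcons_swap_ideal X0 X0 (tder lower_mx (wtensor k (behead w))).
rewrite mul0n expr0 scale1r -mulr2n -scaler_nat => /(memvZ 2%:R^-1).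
by rewrite scalerA mulVf ?scale1r ?two_neq0.
Qed.

(** Normal words containing [X0] have zero differential, and on the others left multiplication by
    [X0] carries distinct free words to distinct normal words, preserving the rank. *)
Lemma diff_rankE k : diff_rank g k = \rank (tder_mx k lower_mx).
Proof.
pose f (s : 'I_#|free_set k|) : k.+1.-tuple L := [tuple of X0 :: fword s].
have finj : injective f by move=> s t [] /val_inj /enum_val_inj.
rewrite -(dim_span_mx (tder_mx k lower_mx) (fun c => wtensor_free (c := c) finj)).
congr (\dim _).
pose h : {linear tensor k -> tensor k.+1} :=
  (@lcons F n.+1 m k X0 \o @tder F n.+1 m lower_mx k)%FUN.
have hI : {in ext_ideal F n.+1 m k, forall u, h u \in ext_ideal F n.+1 m k.+1}.
  move=> u uI; apply: lcons_ideal; exact: tder_ideal lower_mx_odd _ uI.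
have diffE u : nproj (diff g u) = nproj (h u).
  by apply: nproj_congr; exact: diff_lower.
have hnproj u : nproj (h (nproj u)) = nproj (h u).
  exact: (nproj_stable two_neq0 _ hI).
have hrow s : nproj (h (wtensor k (fword s)))
    = \sum_t tder_mx k lower_mx s t *: wtensor k.+1 (f t).
  rewrite /h /= -(nproj_stable two_neq0 _ (@lcons_ideal F n.+1 m k X0)).
  rewrite (nproj_tder_free _ lower_mx_X0).
  rewrite !linear_sum; apply: eq_bigr => t _; rewrite !linearZ /= lcons_wtensor.
  by rewrite nproj_normal // normal_cons_X0 fwordP.
apply/eqP; rewrite eqEsubv; apply/andP; split.
  apply/subvP => _ /memv_imgP[u _ ->]; rewrite comp_lfunE !lfunE /= diffE -hnproj.
  rewrite [nproj u]nproj_sumE !linear_sum; apply: memv_suml => v nv.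
  rewrite !linearZ; apply: memvZ.
  have [Xv|Xv] := boolP (X0 \in tval v).
    rewrite -[X in X \in _]/(nproj (h (wtensor k v))).
    suff /nproj_ideal -> : h (wtensor k v) \in ext_ideal F n.+1 m k.+1 by exact: mem0v.
    exact: lcons_tder_X0.
  have vF : v \in free_set k by rewrite inE nv.
  rewrite -(enum_rankK_in vF vF) -/(fword _).
  rewrite -[X in X \in _]/(nproj (h (wtensor k (fword _)))) hrow.
  by apply: (subvP (sumv_sup _ _ (subvv _))) => //; exact: memv_line.
apply/subv_sumP => s _; rewrite -memvE -hrow -diffE.
have -> : nproj (diff g (wtensor k (fword s)))
  = (linfun (@nproj F n.+1 m k.+1) \o linfun (@diff F n.+1 m g k))%VF
      (wtensor k (fword s)).
  by rewrite comp_lfunE !lfunE.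
by rewrite memv_img ?memvf.
Qed.

End FiliformRank.

(** * Counting middle-weight words *)

(** Sets of different types are compared through encodings in a common type, later pairs of
    sequences of naturals; used in both directions, this replaces an explicit bijection. *)
Lemma leq_card_common_image (T U : finType) (V : eqType) (A : {set T}) (B : {set U})
    (f : T -> V) (h : U -> V) :
  {in A &, injective f} -> (forall x, x \in A -> exists2 y, y \in B & f x = h y) ->
  #|A| <= #|B|.
Proof.
move=> finj AB; rewrite !cardE -(size_map f) -(size_map h).
apply: uniq_leq_size => [|_ /mapP[x xA ->]].
  by rewrite map_inj_in_uniq ?enum_uniq // => x y; rewrite !mem_enum; exact: finj.
rewrite mem_enum in xA; have [y yB ->] := AB x xA.
by apply: map_f; rewrite mem_enum.
Qed.

Lemma seq_of_ord N (s : seq nat) : all (fun x => x < N) s ->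
  exists t : seq 'I_N, map val t = s.
Proof.
elim: s => [|x s IH] /=; first by exists [::].
by case/andP => xN /IH[t <-]; exists (Ordinal xN :: t).
Qed.

(** The shift turning weakly increasing sequences into strictly increasing ones; [c] is the amount
    added to the head. *)
Fixpoint staircase (c : nat) (t : seq nat) : seq nat :=
  if t is x :: t' then (x + c) :: staircase c.+1 t' else [::].

Lemma size_staircase c t : size (staircase c t) = size t.
Proof. by elim: t c => //= x t IH c; rewrite IH. Qed.

Lemma staircase_inj c : injective (staircase c).
Proof. by move=> t t'; elim: t t' c => [|x t IH] [|y t'] c //= [/addIn-> /IH->]. Qed.

Lemma path_staircase c p t : path ltn (p + c) (staircase c.+1 t) = path leq p t.
Proof. by elim: t p c => //= x t IH p c; rewrite addnS ltnS leq_add2r -addnS IH. Qed.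

Lemma path_staircase0 t : path ltn 0 (staircase 0 t) = path leq 1 t.
Proof. by case: t => //= x t; rewrite path_staircase addn0. Qed.

Lemma staircase_surj c p s : path ltn (p + c) s ->
  exists t, s = staircase c.+1 t.
Proof.
elim: s p c => [|x s IH] p c /=; first by exists [::].
move=> /andP[px]; have [d ->] : exists d, x = d + c.+1 by exists (x - c.+1); lia.
by case/IH => t ->; exists (d :: t).
Qed.

Lemma staircase_surj0 s : path ltn 0 s -> exists t, s = staircase 0 t.
Proof.
case: s => [|x s] /=; first by exists [::].
case/andP => _; rewrite -[x]addn0 => /staircase_surj[t ->]; by exists (x :: t).
Qed.

(** In a nondecreasing sequence the last entry is the binding one, and it is shifted by c + size t -
    1. *)
Lemma staircase_bound c m p t : path leq p t ->
  all (fun x => x < m + c + size t) (staircase c t) = all (fun x => x <= m) t.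
Proof.
elim: t p c => //= x t IH p c /andP[_ xt].
have -> : m + c + (size t).+1 = m + c.+1 + size t by lia.
rewrite (IH x) //.
case: t xt {IH} => [|y t] /=; first by rewrite !andbT; lia.
case/andP => xy _; case: (leqP y m) => ym; rewrite ?andbF //=; lia.
Qed.

Lemma sumn_staircase c t :
  sumn (staircase c t) = sumn t + c * size t + 'C(size t, 2).
Proof.
elim: t c => [|x t IH] c /=; first by rewrite muln0.
by rewrite IH binS bin1; lia.
Qed.

Lemma sorted_leq_split n v : sorted leq v ->
  v = [seq x <- v | x <= n] ++ [seq x <- v | n < x].
Proof.
elim: v => //= x v IH xv; have {}IH := IH (path_sorted xv).
rewrite (path_sortedE leq_trans) in xv; case/andP: xv => /allP xv _.
case: leqP => xn /=; first by rewrite -IH.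
rewrite (eq_in_filter (a2 := pred0)) ?filter_pred0 => [|y /xv]; last first.
  by move=> xy; apply/negbTE; rewrite -ltnNge; exact: leq_trans xn xy.
congr cons; rewrite -[LHS]filter_predT; apply: eq_in_filter => y /xv xy.
by rewrite (leq_trans xn xy).
Qed.

Section MiddleCount.
Local Open Scope ring_scope.
Variables (n m : nat).
Local Notation L := 'I_(n.+1 + m).

Definition even_part (v : seq nat) := [seq x <- v | (x <= n)%N].
Definition odd_part (v : seq nat) := [seq (x - n)%N | x <- v & (n < x)%N].

Definition nat_step : rel nat := fun x y => (x < y)%N || (x == y) && (n < x)%N.

Lemma normal_word_nat (w : seq L) : normal_word w = sorted nat_step (map val w).
Proof. by rewrite sorted_map. Qed.

Lemma nat_step_trans : transitive nat_step.
Proof. by move=> y x z; rewrite /nat_step; lia. Qed.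

Lemma parts_split v : sorted nat_step v ->
  v = even_part v ++ map (addn n) (odd_part v).
Proof.
move=> sv; rewrite {1}(@sorted_leq_split n v); last first.
  by apply: sub_sorted sv => x y; rewrite /nat_step; lia.
congr cat; rewrite -map_comp -[LHS]map_id; apply/eq_in_map => x.
by rewrite mem_filter /= => /andP[/ltnW/subnKC-> _].
Qed.

Lemma sorted_parts s t : all (fun x => 0 < x <= n)%N s -> all (ltn 0) t ->
  sorted nat_step (s ++ map (addn n) t) = sorted ltn s && sorted leq t.
Proof.
move=> /allP hs /allP ht.
rewrite (sorted_pairwise nat_step_trans) pairwise_cat pairwise_map.
rewrite (sorted_pairwise ltn_trans) (sorted_pairwise leq_trans).
have -> : allrel nat_step s [seq (n + x)%N | x <- t].
  apply/allrelP => x _ /hs xn /mapP[y /ht y0 ->]; rewrite /nat_step.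
  by move: xn y0 => /=; lia.
have es : {in s &, nat_step =2 ltn}.
  by move=> x y /hs xn _; rewrite /nat_step; lia.
have et : {in t &, relpre (addn n) nat_step =2 leq}.
  by move=> x y /ht /= xn _; rewrite /nat_step /=; lia.
by rewrite (eq_in_pairwise es (allss s)) (eq_in_pairwise et (allss t)).
Qed.

Definition nat_weight (x : nat) : int :=
  if x == 0%N then 0
  else if (x <= n)%N then x%:Z *+ 2 - n.+1%:Z else (x - n)%N%:Z *+ 2 - m.+1%:Z.

Lemma weight_parts (w : seq L) s t : map val w = s ++ map (addn n) t ->
  all (fun x => 0 < x <= n)%N s -> all (ltn 0) t ->
  wweight (@letter_weight n m) w
    = (sumn s + sumn t)%N%:Z *+ 2 - (size s * n.+1 + size t * m.+1)%N%:Z.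
Proof.
move=> wE hs ht.
have -> : wweight (@letter_weight n m) w = \sum_(x <- map val w) nat_weight x.
  by rewrite big_map.
rewrite wE big_cat big_map /=.
have -> : \sum_(x <- s) nat_weight x = (sumn s)%:Z *+ 2 - (size s * n.+1)%N%:Z.
  elim: s hs {wE} => [|x s IH] /=; first by rewrite big_nil.
  case/andP=> /andP[x0 xn] /IH; rewrite big_cons => ->.
  by rewrite /nat_weight gtn_eqF // xn; lia.
have -> : \sum_(x <- t) nat_weight (n + x) = (sumn t)%:Z *+ 2 - (size t * m.+1)%N%:Z.
  elim: t ht {wE} => [|x t IH] /=; first by rewrite big_nil.
  case/andP=> x0 /IH; rewrite big_cons => ->; rewrite /nat_weight addKn.
  have [-> ->] : (n + x == 0)%N = false /\ (n + x <= n)%N = false by split; lia.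
  lia.
lia.
Qed.

(** The two middle weights cover the two parities: 2 S - T is 0 or -1 exactly when S is T / 2
    rounded down. *)
Lemma middle_weight (a b S : nat) (z : int) :
  z = S%:Z *+ 2 - (a * n.+1 + b * m.+1)%N%:Z ->
  (z == 0) || (z == -1) = (S == (a * n.+1 + b * m.+1) %/ 2)%N.
Proof. by move=> ->; set T := (_ + _)%N; lia. Qed.

Definition middle_part k a : {set k.-tuple L} :=
  [set w in middle_set n m k | size (even_part (map val w)) == a].

Lemma even_part_cat s t :
  all (fun x => x <= n)%N s -> all (fun x => 0 < x)%N t ->
  even_part (s ++ map (addn n) t) = s.
Proof.
move=> hs ht; rewrite /even_part filter_cat (all_filterP hs) -[RHS]cats0.
congr cat; rewrite filter_map (eq_in_filter (a2 := pred0)) ?filter_pred0 //.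
by move=> x /(allP ht) /=; lia.
Qed.

Lemma odd_part_cat s t :
  all (fun x => x <= n)%N s -> all (fun x => 0 < x)%N t ->
  odd_part (s ++ map (addn n) t) = t.
Proof.
move=> hs ht; rewrite /odd_part filter_cat (eq_in_filter (a2 := pred0)); last first.
  by move=> x /(allP hs) /=; lia.
rewrite filter_pred0 cat0s filter_map -map_comp (eq_in_filter (a2 := predT)).
  rewrite filter_predT -[RHS]map_id; apply: eq_map => x /=; exact: addKn.
by move=> x /(allP ht) /=; lia.
Qed.

(** Rewrites membership as conditions on the even and odd indices separately: those of
    [filiform_count] before the staircase shift. *)
Lemma middle_part_parts k a (w : k.-tuple L) s t :
  map val w = s ++ map (addn n) t ->
  all (fun x => x <= n)%N s -> all (fun x => 0 < x)%N t ->
  (w \in middle_part k a) =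
    [&& path ltn 0 s, path leq 1 t, size s == a
      & (sumn s + sumn t == (size s * n.+1 + size t * m.+1) %/ 2)%N].
Proof.
move=> wE hs ht; rewrite !inE normal_word_nat wE.
rewrite even_part_cat //.
have pathlt : path ltn 0 s = all (ltn 0) s && sorted ltn s.
  by rewrite path_sortedE //; exact: ltn_trans.
have pathle : path leq 1 t = sorted leq t by rewrite (path_sortedE leq_trans) ht.
have X0w : (X0 n m \notin tval w) = all (ltn 0) s.
  have -> : (X0 n m \in tval w) = (0%N \in map val w).
    by rewrite -(mem_map val_inj).
  rewrite wE mem_cat negb_or -[RHS]andbT; congr (_ && _).
    by rewrite -has_pred1 -all_predC; apply: eq_all => x /=; rewrite lt0n.
  by apply/mapP => -[x /(allP ht) /=]; lia.
rewrite X0w pathlt pathle.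
case: (boolP (all (ltn 0) s)) => [s0|]; last by rewrite !andbF.
have hs' : all (fun x => 0 < x <= n)%N s by rewrite all_predI s0 hs.
rewrite (sorted_parts hs' ht) (middle_weight (weight_parts wE hs' ht)).
by rewrite andbT /= -!andbA; congr (_ && _); congr (_ && _); exact: andbC.
Qed.

Lemma sumn_ord_tuple N c (t : c.-tuple 'I_N) :
  (\sum_(r < c) tnth t r)%N = sumn (map val t).
Proof. by rewrite sumnE big_map big_tuple. Qed.

Lemma card_middle_part k a b : (a + b)%N = k ->
  #|middle_part k a| = filiform_count n m a b.
Proof.
move=> abk; rewrite /filiform_count; set A := [set ij | _].
(* The odd part is shifted so that a word and the pair of tuples it corresponds to have the same
   encoding. *)
pose f (w : k.-tuple L) :=
  (even_part (map val w), staircase 0 (odd_part (map val w))).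
pose h (ij : a.-tuple 'I_n.+1 * b.-tuple 'I_(m + b)) :=
  (map val ij.1, map val ij.2).
have split_w (w : k.-tuple L) : w \in middle_part k a ->
    map val w = even_part (map val w) ++ map (addn n) (odd_part (map val w)).
  rewrite !inE -andbA => /andP[/andP[]]; rewrite normal_word_nat => nw _ _.
  exact: parts_split.
apply/eqP; rewrite eqn_leq; apply/andP; split.
  apply: (@leq_card_common_image _ _ _ _ _ f h).
    move=> w w' /split_w e /split_w e' [ee /staircase_inj eo].
    by apply/val_inj/(inj_map val_inj); rewrite e e' ee eo.
  move=> w wB; have wE := split_w w wB; rewrite /f; move: wE.
  set s := even_part _; set t := odd_part _ => wE.
  have hs : all (fun x => x <= n)%N s by exact: filter_all.
  have ht : all (fun x => 0 < x)%N t.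
    by apply/allP => _ /mapP[x + ->]; rewrite mem_filter subn_gt0 => /andP[].
  have htm : all (fun x => x <= m)%N t.
    apply/allP => _ /mapP[x + ->]; rewrite mem_filter => /andP[_ /mapP[l _ ->]].
    by have := ltn_ord l; rewrite /=; lia.
  move: wB; rewrite (middle_part_parts a wE hs ht) => /and4P[ps pt /eqP sa /eqP sum].
  have sizet : size t = b.
    have := congr1 size wE; rewrite size_map size_tuple size_cat size_map; lia.
  have [i iE] : exists i : seq 'I_n.+1, map val i = s by exact: seq_of_ord.
  have [j jE] : exists j : seq 'I_(m + b), map val j = staircase 0 t.
    by apply: seq_of_ord; rewrite -sizet -[m]addn0 (staircase_bound 0 m pt).
  have sizei : size i == a by rewrite -(size_map val) iE sa.
  have sizej : size j == b by rewrite -(size_map val) jE size_staircase sizet.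
  exists (Tuple sizei, Tuple sizej); last by rewrite /h /= iE jE.
  rewrite inE !sumn_ord_tuple /= iE jE ps path_staircase0 pt /=.
  (* The shift adds the binomial coefficient of b over 2, which is the extra term b (b - 1) / 2 of
     the count. *)
  by rewrite sumn_staircase addn0 sizet bin2 -divn2 addnA sum sa sizet.
apply: (@leq_card_common_image _ _ _ _ _ h f).
  move=> [i j] [i' j'] _ _ [] /(inj_map val_inj)/val_inj-> /(inj_map val_inj)/val_inj->.
  by [].
move=> [i j]; rewrite inE !sumn_ord_tuple /h /= => /and3P[pi pj].
have [t jE] := staircase_surj0 pj; move: pj; rewrite jE path_staircase0 => pt.
have sizet : size t = b by rewrite -(size_staircase 0 t) -jE size_map size_tuple.
rewrite sumn_staircase addn0 sizet bin2 -divn2 addnA eqn_add2r => sum.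
have ht : all (fun x => 0 < x)%N t.
  by move: pt; rewrite (path_sortedE leq_trans) => /andP[].
have htm : all (fun x => x <= m)%N t.
  rewrite -(staircase_bound 0 m pt) -jE addn0 sizet.
  by apply/allP => _ /mapP[x _ ->] /=.
have hs : all (fun x => x <= n)%N (map val i).
  by apply/allP => _ /mapP[x _ ->]; rewrite -ltnS /=.
have [w wE] : exists w : seq L, map val w = map val i ++ map (addn n) t.
  apply: seq_of_ord; rewrite all_cat; apply/andP; split.
    by apply: sub_all hs => x; lia.
  by rewrite all_map; apply: sub_all htm => x /=; lia.
have sizew : size w == k.
  by rewrite -(size_map val) wE size_cat !size_map size_tuple sizet abk.
exists (Tuple sizew); last by rewrite /f /= wE even_part_cat // odd_part_cat.
rewrite (middle_part_parts (w := Tuple sizew) a wE hs ht) pi pt /=.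
by rewrite size_map size_tuple eqxx sizet.
Qed.

(** Words are grouped by their number of even letters, which is at most [k], so [inord] loses
    nothing. *)
Lemma card_middle_set k :
  #|middle_set n m k| = (\sum_(0 <= a < k.+1) filiform_count n m a (k - a))%N.
Proof.
rewrite big_mkord.
have evk (w : k.-tuple L) : (size (even_part (map val w)) < k.+1)%N.
  by rewrite ltnS -[leqRHS](size_tuple w) -(size_map val) size_filter count_size.
rewrite -sum1_card (partition_big (fun w : k.-tuple L =>
  inord (size (even_part (map val w))) : 'I_k.+1) predT) //=.
apply: eq_bigr => a _; rewrite -(card_middle_part (k := k)); last first.
  by rewrite subnKC // -ltnS.
rewrite -sum1_card; apply: eq_bigl => w; rewrite [in RHS]inE; congr (_ && _).
by rewrite -val_eqE /= inordK.
Qed.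

End MiddleCount.

(** * Normal words with and without X_0, and the final count *)

Section NormalWords.
Variables n m : nat.

Lemma normal_set0 : normal_set n.+1 m 0 = free_set n m 0.
Proof. by apply/setP => w; rewrite !inE (tuple0 w). Qed.

Lemma card_normal_setS k :
  #|normal_set n.+1 m k.+1| = #|free_set n m k.+1| + #|free_set n m k|.
Proof.
pose c (w : k.-tuple 'I_(n.+1 + m)) : k.+1.-tuple 'I_(n.+1 + m) :=
  [tuple of X0 n m :: w].
have cinj : injective c by move=> w w' [] /val_inj.
rewrite -(card_imset _ cinj) -cardsUI [X in _ = _ + #|pred_of_set X|](_ : _ = set0).
  rewrite cards0 addn0; congr #|pred_of_set _|; apply/setP => w; rewrite !inE.
  apply/idP/orP => [nw|[/andP[]//|/imsetP[w']]]; last first.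
    by rewrite inE -normal_cons_X0 => nw ->.
  have [Xw|Xw] := boolP (X0 n m \in tval w); last by left; rewrite nw.
  right; have wE := normal_X0_head nw Xw; apply/imsetP.
  exists [tuple of behead w]; last by apply: val_inj.
  by rewrite inE -normal_cons_X0 -wE.
apply/setP => w; rewrite !inE; apply/negP => /andP[/andP[_ Xw] /imsetP[w' _ wE]].
by case/negP: Xw; rewrite wE mem_head.
Qed.
End NormalWords.

Theorem theorem2 (F : closedFieldType) (hF : [pchar F]%R =i pred0)
    (n m : nat) (hn : 1 <= n) (hm : 1 <= m) (k : nat) :
  dim_cohomology (model_filiform F n m) k =
    \sum_(0 <= k0 < k.+1) filiform_count n m k0 (k - k0)
    + \sum_(0 <= k0 < k) filiform_count n m k0 (k - k0 - 1).
Proof.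
rewrite -card_middle_set.
have rk j := rank_tder_lower n m hF j.
case: k => [|k].
  rewrite big_geq // addn0 dim_cohomology0 ?two_neq0 // normal_set0 diff_rankE //.
  have := rk 0; lia.
rewrite (eq_bigr (fun j => filiform_count n m j (k - j))) => [|j _]; last first.
  by congr filiform_count; lia.
(* With f free words and m middle words in each degree, the dimension is f_(k+1) + f_k - (f_(k+1) -
   m_(k+1)) - (f_k - m_k) = m_(k+1) + m_k. *)
rewrite -card_middle_set dim_cohomologyS ?two_neq0 // card_normal_setS !diff_rankE //.
have := rk k.+1; have := rk k; lia.
Qed.
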